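(* Let $G$ be a locally compact group and let $P\subset G$ be a closed subsemigroup containing the identity such that $G=PP^{-1}$ and the interior $\mathrm{Int}(P)$ of $P$ in $G$ is dense in $P$. Let $X$ be the order compactification of $P$, with $P$ acting by right multiplication. Then: (1) The groupoid $X\rtimes P$ has a Haar system. (2) The pair $(X,P)$ satisfies conditions (A1), (A2) and (A3) (listed in the context). (3) Suppose $\widetilde{X}$ is a compact Hausdorff space with an injective right action of $P$ such that $\widetilde{X}\rtimes P$ has a Haar system and $(\widetilde X,P)$ satisfies (A1), (A2) and (A3). Then the map $\widetilde{X}\ni x\mapsto Q_x^{-1}\in X$ is a $P$-equivariant homeomorphism.
   Context: All topological spaces are Hausdorff and second countable. A right action of $P$ on a compact space $X$ is a continuous map $X\times P\to X$, $(x,a)\mapsto xa$, with $xe=x$ and $(xa)b=x(ab)$; it is injective if $x\mapsto xa$ is injective for every $a\in P$. For an injective right action of $P$ on a compact space $X$, the semi-direct product groupoid is $$X\rtimes P=\{(x,g)\in X\times G:\ \exists\, a,b\in P,\ y\in X \text{ with } g=ab^{-1},\ xa=yb\},$$ a closed subset of $X\times G$ with the subspace topology. For $(x,g)\in X\rtimes P$, $s(x,g)$ is the unique $y\in X$ such that $xa=yb$ whenever $g=ab^{-1}$ with $a,b\in P$; $r(x,g)=x$; $(x,g)(y,h)=(x,gh)$ when $y=s(x,g)$; $(x,g)^{-1}=(s(x,g),g^{-1})$. It is a locally compact Hausdorff topological groupoid with unit space $X$. For $x\in X$, $Q_x=\{g\in G:(x,g)\in X\rtimes P\}$, and $Q_x^{-1}=\{g^{-1}:g\in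 Q_x\}$. ''Haar system'' means left Haar system. Conditions on $(X,P)$: (A1) there exists $x_0\in X$ such that $Q_{x_0}=P$; (A2) with this $x_0$, the set $\{x_0a: a\in P\}$ is dense in $X$; (A3) for $x,y\in X$, if $Q_x=Q_y$ then $x=y$. Order compactification: let $\mathcal{C}(G)$ be the set of all closed subsets of $G$ with the Vietoris topology, a compact metrizable topology in which (fixing a compatible metric $d$ on $G$) a sequence $(A_n)$ converges to $A$ if and only if $\liminf A_n=\limsup A_n=A$, where $\liminf A_n=\{x:\limsup_n d(x,A_n)=0\}$ and $\limsup A_n=\{x:\liminf_n d(x,A_n)=0\}$. $G$ acts on $\mathcal{C}(G)$ on the right by $Ag=\{ag:a\in A\}$. The order compactification of $P$ is the closure of $\{P^{-1}a:a\in P\}$ in $\mathcal{C}(G)$; it is invariant under right multiplication by elements of $P$. *)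

(* Defs.v *)
From HB Require Import structures.
From mathcomp Require Import all_boot all_order all_algebra finmap.
From mathcomp Require Import all_classical all_reals all_analysis.
Set Implicit Arguments.
Unset Strict Implicit.
Unset Printing Implicit Defensive.
Import Order.TTheory GRing.Theory Num.Theory.
Import numFieldNormedType.Exports.
Local Open Scope classical_set_scope.
Local Open Scope group_scope.

HB.mixin Record isTopologicalGroup G & Topological G & Group G := {
  mulg_continuous : continuous (fun z : G * G => z.1 * z.2);
  invg_continuous : continuous (fun x : G => x^-1)
}.

#[short(type="topologicalGroupType")]
HB.structure Definition TopologicalGroup :=
  {G of isTopologicalGroup G & Topological G & Group G}.

(* Submonoids of G; the elements of P form the type [set_type P], with the
   subspace topology. *)
Record submonoid (G : groupType) := Submonoid {
  submonoid_set :> set G;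
  submonoid1 : submonoid_set 1;
  submonoidM : forall a b, submonoid_set a -> submonoid_set b ->
    submonoid_set (a * b)
}.

Definition setV (G : groupType) (A : set G) : set G := [set x^-1 | x in A].
Definition setMr (G : groupType) (A : set G) (g : G) : set G :=
  [set x * g | x in A].

Section submonoid_elements.
Context (G : groupType) (P : submonoid G).

Definition sub1 : P := exist _ 1 (mem_set (submonoid1 P)).

Definition subM (a b : P) : P :=
  exist _ (val a * val b)
    (mem_set (submonoidM (set_mem (valP a)) (set_mem (valP b)))).

End submonoid_elements.

Record injective_action (G : topologicalGroupType) (P : submonoid G)
    (X : topologicalType) := InjectiveAction {
  act :> X -> P -> X;
  act_continuous : continuous (fun z : X * P => act z.1 z.2);
  act1 : forall x, act x (sub1 P) = x;
  actM : forall x a b, act (act x a) b = act x (subM a b);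
  act_inj : forall a, injective (act^~ a)
}.

(* Groupoids whose arrow and unit spaces carry a topology. The product
   [gpd_comp g h] is only meaningful when [gpd_src g = gpd_rng h]; its value
   on other pairs is irrelevant. The arrow space is pointed (i.e. nonempty)
   because measurable types are. *)
Record groupoid := Groupoid {
  gpd_arrow :> ptopologicalType;
  gpd_unit : topologicalType;
  gpd_rng : gpd_arrow -> gpd_unit;
  gpd_src : gpd_arrow -> gpd_unit;
  gpd_id : gpd_unit -> gpd_arrow;
  gpd_comp : gpd_arrow -> gpd_arrow -> gpd_arrow;
  gpd_inv : gpd_arrow -> gpd_arrow;
  gpd_rng_id : forall x, gpd_rng (gpd_id x) = x;
  gpd_src_id : forall x, gpd_src (gpd_id x) = x;
  gpd_rng_inv : forall g, gpd_rng (gpd_inv g) = gpd_src g;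
  gpd_src_inv : forall g, gpd_src (gpd_inv g) = gpd_rng g;
  gpd_rng_comp : forall g h, gpd_src g = gpd_rng h ->
    gpd_rng (gpd_comp g h) = gpd_rng g;
  gpd_src_comp : forall g h, gpd_src g = gpd_rng h ->
    gpd_src (gpd_comp g h) = gpd_src h;
  gpd_compA : forall g h k, gpd_src g = gpd_rng h -> gpd_src h = gpd_rng k ->
    gpd_comp (gpd_comp g h) k = gpd_comp g (gpd_comp h k);
  gpd_comp1g : forall g, gpd_comp (gpd_id (gpd_rng g)) g = g;
  gpd_compg1 : forall g, gpd_comp g (gpd_id (gpd_src g)) = g;
  gpd_compgV : forall g, gpd_comp g (gpd_inv g) = gpd_id (gpd_rng g);
  gpd_compVg : forall g, gpd_comp (gpd_inv g) g = gpd_id (gpd_src g)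
}.

Section haar_system.
Local Open Scope ring_scope.
Context (R : realType).

Definition borelType (T : ptopologicalType) := g_sigma_algebraType (@open T).

Definition measure_support (T : ptopologicalType)
    (mu : {measure set (borelType T) -> \bar R}) : set T :=
  [set t | forall U : set T, open U -> U t -> (0 < mu U)%E].

Definition compactly_supported (T : topologicalType) (f : T -> R) :=
  compact (closure [set t | f t != 0]).

(* Finiteness on compact sets suffices to define Radon measures here: on a
   second countable locally compact Hausdorff space such Borel measures are
   automatically regular. *)
Record is_haar_system (Gam : groupoid)
    (lam : gpd_unit Gam -> {measure set (borelType Gam) -> \bar R}) : Prop := {
  haar_radon : forall x (K : set Gam), compact K -> (lam x K < +oo)%E;
  haar_support : forall x,
    measure_support (lam x) = [set g | gpd_rng g = x];
  haar_continuous : forall f : Gam -> R,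
    continuous f -> compactly_supported f ->
    continuous (fun x => \int[lam x]_g f g);
  haar_invariant : forall (g : Gam) (f : Gam -> R),
    continuous f -> compactly_supported f ->
    \int[lam (gpd_src g)]_(h in [set h | gpd_rng h = gpd_src g])
      f (gpd_comp g h)
    = \int[lam (gpd_rng g)]_h f h
}.

Definition has_haar_system (Gam : groupoid) :=
  exists lam, @is_haar_system Gam lam.

End haar_system.

Section semidirect.
Context (G : topologicalGroupType) (P : submonoid G).
Hypothesis Pgen : forall g : G, exists a b : P, g = val a / val b.

Section arrows.
Context (X : ptopologicalType) (A : injective_action P X).

Definition sdp_set : set (X * G) :=
  [set z | exists (a b : P) (y : X), z.2 = val a / val b /\ A z.1 a = A y b].

Lemma sdp_set1 x : sdp_set (x, 1).
Proof.
by exists (sub1 P), (sub1 P), x; split=> //=; rewrite divgg.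
Qed.

Definition sdp : Type := set_type sdp_set.
HB.instance Definition _ := Topological.on sdp.

Definition sdp_mk z (zS : sdp_set z) : sdp := exist _ z (mem_set zS).

Definition sdp_id (x : X) : sdp := sdp_mk (sdp_set1 x).

HB.instance Definition _ := isPointed.Build sdp (sdp_id point).

Definition sdp_rng (g : sdp) : X := (val g).1.

Lemma sdp_src_ex (g : sdp) : exists y : X, forall a b : P,
  (val g).2 = val a / val b -> A (val g).1 a = A y b.
Proof.
case: g => -[x g] /= /set_mem[a [b [y [/= -> xayb]]]].
exists y => c d eq_ab.
have [e [f eq_ef]] := Pgen ((val a)^-1 * val c).
have ae : subM a e = subM c f.
  apply: val_inj => /=; apply: (mulIg (val f)^-1).
  by rewrite -mulgA -eq_ef mulgA mulgV mul1g mulgK.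
have be : subM b e = subM d f.
  apply: val_inj => /=; apply: (mulIg (val f)^-1).
  rewrite -mulgA -eq_ef mulgK mulgA.
  have -> : val b / val a = val d / val c.
    by rewrite -[LHS]invgK invgF eq_ab invgF.
  by rewrite mulgVK.
by apply: (@act_inj _ _ _ A f); rewrite /= !actM -ae -be -!actM xayb.
Qed.

Definition sdp_src (g : sdp) : X := sval (cid (sdp_src_ex g)).

Lemma sdp_srcP (g : sdp) (a b : P) :
  (val g).2 = val a / val b -> A (val g).1 a = A (sdp_src g) b.
Proof. exact: (svalP (cid (sdp_src_ex g))). Qed.

Lemma sdp_src_unique (g : sdp) (a b : P) (y : X) :
  (val g).2 = val a / val b -> A (val g).1 a = A y b -> sdp_src g = y.
Proof.
by move=> gab; rewrite (sdp_srcP gab); apply: (@act_inj _ _ _ A b).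
Qed.

Lemma sdp_set_comp (g h : sdp) : sdp_src g = sdp_rng h ->
  sdp_set ((val g).1, (val g).2 * (val h).2) /\
  forall k : sdp, val k = ((val g).1, (val g).2 * (val h).2) ->
    sdp_src k = sdp_src h.
Proof.
move=> gh.
have [a [b gab]] := Pgen (val g).2.
have [c [d hcd]] := Pgen (val h).2.
have [e [f bc]] := Pgen ((val b)^-1 * val c).
have be : subM b e = subM c f.
  apply: val_inj => /=; apply: (mulIg (val f)^-1).
  by rewrite -mulgA -bc mulgA mulgV mul1g mulgK.
have Eact : A (val g).1 (subM a e) = A (sdp_src h) (subM d f).
  by rewrite -!actM (sdp_srcP gab) gh actM be -actM (sdp_srcP hcd).
have Eg : (val g).2 * (val h).2 = val (subM a e) / val (subM d f).
  by rewrite gab hcd /= invgM mulgA -(mulgA (val a)) bc !mulgA.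
split; first by exists (subM a e), (subM d f), (sdp_src h).
move=> k kE; apply: (@sdp_src_unique _ (subM a e) (subM d f)); by rewrite kE.
Qed.

Definition sdp_comp (g h : sdp) : sdp :=
  match pselect (sdp_src g = sdp_rng h) with
  | left gh => sdp_mk (sdp_set_comp gh).1
  | right _ => g
  end.

Lemma sdp_set_inv (g : sdp) : sdp_set (sdp_src g, (val g).2^-1).
Proof.
have [a [b gab]] := Pgen (val g).2.
exists b, a, (val g).1; split; first by rewrite /= gab invgF.
by rewrite (sdp_srcP gab).
Qed.

Definition sdp_inv (g : sdp) : sdp := sdp_mk (sdp_set_inv g).

Lemma sdp_compE g h : sdp_src g = sdp_rng h ->
  val (sdp_comp g h) = ((val g).1, (val g).2 * (val h).2).
Proof. by rewrite /sdp_comp; case: pselect. Qed.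

Lemma sdp_src_comp g h : sdp_src g = sdp_rng h ->
  sdp_src (sdp_comp g h) = sdp_src h.
Proof. by move=> gh; apply: (sdp_set_comp gh).2; exact: sdp_compE. Qed.

Lemma sdp_rng_comp g h : sdp_src g = sdp_rng h ->
  sdp_rng (sdp_comp g h) = sdp_rng g.
Proof. by move=> gh; rewrite /sdp_rng sdp_compE. Qed.

Lemma sdp_src_id x : sdp_src (sdp_id x) = x.
Proof.
by apply: (@sdp_src_unique _ (sub1 P) (sub1 P)); rewrite //= divgg.
Qed.

Lemma sdp_src_inv g : sdp_src (sdp_inv g) = sdp_rng g.
Proof.
have [a [b gab]] := Pgen (val g).2.
apply: (@sdp_src_unique _ b a); first by rewrite /= gab invgF.
by rewrite /= (sdp_srcP gab).
Qed.

Lemma sdp_compA g h k : sdp_src g = sdp_rng h -> sdp_src h = sdp_rng k ->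
  sdp_comp (sdp_comp g h) k = sdp_comp g (sdp_comp h k).
Proof.
move=> gh hk; apply: val_inj.
rewrite sdp_compE ?sdp_src_comp// sdp_compE// sdp_compE ?sdp_rng_comp//.
by rewrite sdp_compE//= mulgA.
Qed.

Lemma sdp_comp1g g : sdp_comp (sdp_id (sdp_rng g)) g = g.
Proof.
apply: val_inj; rewrite sdp_compE ?sdp_src_id//= mul1g.
by rewrite /sdp_rng -surjective_pairing.
Qed.

Lemma sdp_compg1 g : sdp_comp g (sdp_id (sdp_src g)) = g.
Proof.
by apply: val_inj; rewrite sdp_compE//= mulg1 -surjective_pairing.
Qed.

Lemma sdp_compgV g : sdp_comp g (sdp_inv g) = sdp_id (sdp_rng g).
Proof. by apply: val_inj; rewrite sdp_compE//= mulgV. Qed.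

Lemma sdp_compVg g : sdp_comp (sdp_inv g) g = sdp_id (sdp_src g).
Proof. by apply: val_inj; rewrite sdp_compE ?sdp_src_inv//= mulVg. Qed.

Definition semidirect : groupoid :=
  @Groupoid sdp X sdp_rng sdp_src sdp_id sdp_comp sdp_inv
    (fun=> erefl) sdp_src_id (fun=> erefl) sdp_src_inv
    sdp_rng_comp sdp_src_comp sdp_compA sdp_comp1g sdp_compg1
    sdp_compgV sdp_compVg.

Definition Qset (x : X) : set G := [set g | sdp_set (x, g)].

Definition conditionA1 (x0 : X) := Qset x0 = P.
Definition conditionA2 (x0 : X) := dense (range (A x0)).
Definition conditionA3 := injective Qset.

Definition conditionsA :=
  (exists x0, conditionA1 x0 /\ conditionA2 x0) /\ conditionA3.

End arrows.
End semidirect.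

Section vietoris.
Context (T : topologicalType).

Record closedSet := ClosedSet {
  closedSet_set :> set T;
  closedSetP : closed closedSet_set
}.

Lemma closedSet_inj (A B : closedSet) : A = B :> set T -> A = B.
Proof.
case: A B => [A cA] [B cB] /= AB; subst B; congr ClosedSet.
exact: Prop_irrelevance.
Qed.

HB.instance Definition _ := gen_eqMixin closedSet.
HB.instance Definition _ := gen_choiceMixin closedSet.

Definition misses (K : set T) : set closedSet :=
  [set A : closedSet | A `&` K = set0].
Definition hits (U : set T) : set closedSet :=
  [set A : closedSet | A `&` U !=set0].

(* The locally compact form of the Vietoris topology (also called the Fell
   topology): only compact sets are to be missed, which makes the hyperspace
   compact for locally compact T. *)
Definition vietoris_subbase : set (set closedSet) :=
  misses @` compact `|` hits @` open.

HB.instance Definition _ :=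
  isSubBaseTopological.Build closedSet vietoris_subbase id.

Lemma vietoris_subbase_open : vietoris_subbase `<=` open.
Proof.
move=> W sW; exists [set W]; last first.
  by rewrite predeqE => A; split=> [[_ ->]|] //; exists W.
move=> _ ->; exists [fset W]%fset; first by move=> V /fset1P ->; exact/mem_set.
rewrite predeqE => A; split=> [|WA V /=]; first by apply; rewrite /= inE.
by move/fset1P ->.
Qed.

Lemma open_misses K : compact K -> open (misses K).
Proof. by move=> cK; apply: vietoris_subbase_open; left; exists K. Qed.

Lemma open_hits U : open U -> open (hits U).
Proof. by move=> oU; apply: vietoris_subbase_open; right; exists U. Qed.

Lemma cvg_vietoris (F : set_system closedSet) (A : closedSet) : Filter F ->
  (forall K, compact K -> misses K A -> F (misses K)) ->
  (forall U, open U -> hits U A -> F (hits U)) ->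
  F --> A.
Proof.
move=> FF Fmiss Fhit V; rewrite nbhsE => -[_ [[B sB <-] [C BC CA] sUV]].
rewrite nbhs_filterE; apply: filterS sUV _; apply: (@filterS _ _ _ C).
  by move=> ? ?; exists C.
have /sB [D sD IDeC] := BC; rewrite -IDeC; apply: filter_bigI => E DE.
have EA : E A by move: CA; rewrite -IDeC => /(_ _ DE).
have /sD := DE; rewrite inE => -[[K cK EK]|[U oU EU]]; subst E.
- exact: Fmiss.
- exact: Fhit.
Qed.

End vietoris.

Arguments closedSetP {T} c.

Arguments misses {T} K.
Arguments hits {T} U.

(* Topological form of the lower and upper Kuratowski limits of a sequence of
   sets: when d is a compatible metric, every neighborhood of x eventually
   (resp. frequently) meets A_n iff limsup_n d(x, A_n) = 0
   (resp. liminf_n d(x, A_n) = 0). *)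
Section kuratowski.
Context (T : topologicalType).

Definition lower_limit (A : nat -> set T) : set T :=
  [set x | forall U, nbhs x U -> \forall n \near \oo, A n `&` U !=set0].
Definition upper_limit (A : nat -> set T) : set T :=
  [set x | forall U, nbhs x U ->
    forall N, exists2 n, (N <= n)%N & A n `&` U !=set0].

Lemma vietoris_cvgP (A_ : nat -> closedSet T) (A : closedSet T) :
  hausdorff_space T -> locally_compact [set: T] ->
  A_ @ \oo --> A <->
  lower_limit (fun n => A_ n) = A :> set T /\
  upper_limit (fun n => A_ n) = A :> set T.
Proof.
move=> hT lcT.
have lu (B_ : nat -> set T) : lower_limit B_ `<=` upper_limit B_.
  move=> x lx U /lx [N _ NU] M; exists (maxn N M); first exact: leq_maxr.
  by apply: NU => /=; exact: leq_maxl.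
split.
- move=> cvA.
  have Al : A `<=` lower_limit (fun n => A_ n).
    move=> x Ax U; rewrite nbhsE => -[V [oV Vx] VU].
    have : \forall n \near \oo, hits V (A_ n).
      apply: cvA; apply: open_nbhs_nbhs; split; first exact: open_hits.
      by exists x.
    by apply: filterS => n [y [Any Vy]]; exists y; split=> //; exact: VU.
  have uA : upper_limit (fun n => A_ n) `<=` A.
    move=> x ux; apply: contrapT => nAx.
    have [K] := lcT x I; rewrite withinET => Kx [cK _].
    have reg := compact_regular hT cK Kx.
    have nbA : nbhs x (~` (A : set _)).
      apply: open_nbhs_nbhs; split=> //.
      exact/closed_openC/closedSetP.
    have [V Vx clVA] := reg _ nbA.
    have cKV : compact (K `&` closure V).
      by apply: compact_closedI => //; exact: closed_closure.
    have : \forall n \near \oo, misses (K `&` closure V) (A_ n).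
      apply: cvA; apply: open_nbhs_nbhs; split; first exact: open_misses.
      by rewrite /misses /= -subset0 => y [Ay [_ /clVA]].
    case=> N _ NK; have [n Nn [y [Any [Ky Vy]]]] := ux _ (filterI Kx Vx) N.
    have : (A_ n `&` (K `&` closure V)) y.
      by split=> //; split=> //; exact: subset_closure.
    by rewrite (NK n Nn).
  split; rewrite eqEsubset; split=> //.
  + by apply: subset_trans uA; exact: lu.
  + by apply: subset_trans (lu _).
- case=> lA uA; apply: cvg_vietoris.
  + move=> K cK KA; rewrite nbhs_filterE.
    have /compact_near_coveringP cov := cK.
    have := cov nat \oo (fun n x => ~ (A_ n : set T) x) _.
    have covA x : K x -> \forall x' \near x & n \near \oo, ~ (A_ n : set T) x'.
      move=> Kx.
      have : ~ upper_limit (fun n => A_ n) x.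
        rewrite uA => Ax; have : (A `&` K) x by [].
        by rewrite KA.
      move=> /existsNP[U] /not_implyP[Ux] /existsNP[N] Nn.
      exists (U, [set n | (N <= n)%N]); first by split=> //; exists N.
      move=> [y n] /= [Uy Nle] Any; apply: Nn; exists n => //.
      by exists y.
    move=> /(_ _ covA); apply: filterS => n nK.
    by rewrite /misses /= -subset0 => y [Any /nK].
  + move=> U oU [x [Ax Ux]]; rewrite nbhs_filterE.
    move: Ax; rewrite -lA => /(_ U); apply.
    exact: open_nbhs_nbhs.
Qed.

End kuratowski.

Section order_compactification.
Context (G : topologicalGroupType).

Lemma setVE (A : set G) : setV A = (fun x => x^-1) @^-1` A.
Proof.
rewrite eqEsubset; split=> [_ [x Ax <-]|x Ax]; first by rewrite /= invgK.
by exists x^-1 => //; rewrite invgK.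
Qed.

Lemma setMrE (A : set G) (g : G) : setMr A g = (fun x => x / g) @^-1` A.
Proof.
rewrite eqEsubset; split=> [_ [x Ax <-]|x Ax]; first by rewrite /= mulgK.
by exists (x / g) => //; rewrite mulgVK.
Qed.

Lemma mulgr_continuous (g : G) : continuous (fun x : G => x * g).
Proof.
move=> x.
apply: (@continuous_comp _ _ _ (fun x => (x, g)) (fun z => z.1 * z.2)).
  by apply: cvg_pair => //=; exact: cvg_cst.
exact: mulg_continuous.
Qed.

Lemma closed_setV (A : set G) : closed A -> closed (setV A).
Proof.
move=> cA; rewrite setVE; apply: preimage_closed => // x _.
exact: invg_continuous.
Qed.

Lemma closed_setMr (A : set G) (g : G) : closed A -> closed (setMr A g).
Proof.
move=> cA; rewrite setMrE; apply: preimage_closed => // x _.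
exact: mulgr_continuous.
Qed.

Definition closedMr (A : closedSet G) (g : G) : closedSet G :=
  ClosedSet (@closed_setMr A g (closedSetP A)).

Lemma closedMr1 A : closedMr A 1 = A.
Proof.
apply: closedSet_inj => /=; rewrite setMrE; apply/funext => x /=.
by rewrite invg1 mulg1.
Qed.

Lemma closedMrM A g h : closedMr (closedMr A g) h = closedMr A (g * h).
Proof.
apply: closedSet_inj => /=; rewrite !setMrE; apply/funext => x /=.
by rewrite invgM mulgA.
Qed.

Lemma closedMr_inj g : injective (closedMr^~ g).
Proof.
by move=> A B /(congr1 (closedMr^~ g^-1)); rewrite !closedMrM mulgV !closedMr1.
Qed.

Lemma closedMr_continuous : hausdorff_space G -> locally_compact [set: G] ->
  continuous (fun z : closedSet G * G => closedMr z.1 z.2).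
Proof.
move=> hG lcG [A g]; apply: cvg_vietoris => /=.
- move=> K cK KA.
  have nA x : K x -> ~ (A : set G) (x / g).
    move=> Kx Ax; have : (closedMr A g `&` K) x.
      by split=> //=; rewrite setMrE.
    by rewrite KA.
  have div_cts : continuous (fun z : G * G => z.1 / z.2).
    move=> z; apply: (@continuous_comp _ _ _ (fun z : G * G => (z.1, z.2^-1))
      (fun z => z.1 * z.2)); last exact: mulg_continuous.
    apply: cvg_pair => /=; first exact: cvg_fst.
    by apply: continuous_comp; [exact: cvg_snd | exact: invg_continuous].
  have oA : open (~` (A : set G)) by exact/closed_openC/closedSetP.
  have /compact_near_coveringP cov := cK.
  have covA x : K x -> \forall x' \near x & h \near g, ~ (A : set G) (x' / h).
    move=> Kx.
    have nbx : nbhs (x / g) (~` (A : set G)).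
      by apply: open_nbhs_nbhs; split=> //; exact: nA.
    exact: (div_cts (x, g) _ nbx).
  have gW := cov G (nbhs g) (fun h x => ~ (A : set G) (x / h))
    (nbhs_filter g) covA.
  have [W0] := lcG g I; rewrite withinET => W0g [cW0 _].
  have [V Vg clV] := compact_regular hG cW0 W0g gW.
  pose K' := (fun z : G * G => z.1 / z.2) @` (K `*` (W0 `&` closure V)).
  have cK' : compact K'.
    apply: continuous_compact; first exact: continuous_subspaceT.
    apply: compact_setX => //; apply: compact_closedI => //.
    exact: closed_closure.
  have mA : misses K' A.
    rewrite /misses /= -subset0 => y [Ay [[x h] [/= Kx [_ /clV hA]] eq_y]].
    by apply: (hA x Kx); rewrite /= eq_y.
  exists (misses K', W0 `&` V) => /=.
    split; last exact: filterI.
    by apply: open_nbhs_nbhs; split=> //; exact: open_misses.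
  move=> [B h] /= [BK' [W0h Vh]].
  rewrite /misses /= -subset0 setMrE => x [Bx Kx].
  have : (B `&` K') (x / h).
    split=> //; exists (x, h) => //=; split=> //; split=> //.
    exact: subset_closure.
  by rewrite BK'.
- move=> U oU [_ [[a Aa <-] Uag]].
  have := mulg_continuous (a, g); move/(_ U); rewrite /= nbhs_filterE.
  case; first exact: open_nbhs_nbhs.
  move=> [V W] /= [Va Wg] VWU.
  move: Va; rewrite nbhsE => -[V' [oV' V'a] V'V].
  exists (hits V', W) => /=.
    split=> //; apply: open_nbhs_nbhs; split; first exact: open_hits.
    by exists a.
  move=> [B h] /= [[b [Bb V'b]] Wh]; exists (b * h); split; first by exists b.
  by apply: (VWU (b, h)); split=> //; exact: V'V.
Qed.

Section compactification.
Context (P : submonoid G) (Pclosed : closed P).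

Let Pinv : closedSet G := ClosedSet (closed_setV Pclosed).

Definition order_closure : set (closedSet G) :=
  closure [set closedMr Pinv a | a in (P : set G)].

Definition order_compactification : Type := set_type order_closure.
HB.instance Definition _ := Topological.on order_compactification.

Lemma order_closure1 : order_closure Pinv.
Proof.
by apply: subset_closure; exists 1; [exact: submonoid1|exact: closedMr1].
Qed.

HB.instance Definition _ := isPointed.Build order_compactification
  (exist _ Pinv (mem_set order_closure1)).

Hypotheses (hG : hausdorff_space G) (lcG : locally_compact [set: G]).

Lemma order_closureM (A : order_compactification) (a : P) :
  order_closure (closedMr (val A) (val a)).
Proof.
have cts : continuous (closedMr^~ (val a)).
  move=> B; set f := fun B : closedSet G => (B, val a : G).
  have fB : {for B, continuous f}.
    move=> U [[V W] /= [VB Wa] VWU]; rewrite nbhs_filterE.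
    apply: filterS VB => C VC; apply: VWU; split=> //=.
    exact: nbhs_singleton.
  exact: (continuous_comp fB (closedMr_continuous hG lcG (x := (B, val a)))).
move=> U /cts /(set_mem (valP A)) [_ [[b Pb <-] /= Uba]].
exists (closedMr Pinv (b * val a)); split; last by rewrite -closedMrM.
by exists (b * val a) => //; apply: submonoidM => //; exact: set_mem (valP a).
Qed.

Definition order_act (A : order_compactification) (a : P) :
    order_compactification :=
  exist (fun B => B \in order_closure) _
    (mem_set (@order_closureM A a)).

Lemma order_act_continuous :
  continuous (fun z : order_compactification * P => order_act z.1 z.2).
Proof.
apply: (@continuous_comp_initial _ _ _ (@set_val _ order_closure)).
move=> [A a]; set f := fun z : order_compactification * P =>
  (set_val z.1, set_val z.2) : closedSet G * G.
have fAa : {for (A, a), continuous f}.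
  move=> U [[V W] /= [VA Wa] VWU]; rewrite nbhs_filterE.
  exists (set_val @^-1` V, set_val @^-1` W) => /=.
    by split; [exact: (initial_continuous VA)|exact: (initial_continuous Wa)].
  by move=> [B b] /= [VB Wb]; exact: VWU.
exact: (continuous_comp fAa (closedMr_continuous hG lcG (x := f (A, a)))).
Qed.

Lemma order_act1 A : order_act A (sub1 P) = A.
Proof. by apply: val_inj; exact: closedMr1. Qed.

Lemma order_actM A a b : order_act (order_act A a) b = order_act A (subM a b).
Proof. by apply: val_inj; exact: closedMrM. Qed.

Lemma order_act_inj a : injective (order_act^~ a).
Proof.
by move=> A B /(congr1 val) /= /closedMr_inj AB; exact: val_inj.
Qed.

Definition order_action : injective_action P order_compactification :=
  InjectiveAction order_act_continuous order_act1 order_actM order_act_inj.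

End compactification.
End order_compactification.

Definition equivariant (G : topologicalGroupType) (P : submonoid G)
    (X Y : topologicalType) (A : injective_action P X)
    (B : injective_action P Y) (f : X -> Y) :=
  forall x a, f (A x a) = B (f x) a.

Definition homeomorphism (X Y : topologicalType) (f : X -> Y) :=
  continuous f /\ exists g : Y -> X, [/\ cancel f g, cancel g f & continuous g].

(* Main.v *)
(* (1) For A in the order compactification X one has Q_A = A^-1, and A^-1 P is
   contained in A^-1, so A^-1 has dense interior. With mu a left Haar measure
   of G (obtained from covering numbers), mu restricted to Q_A is the desired
   Haar system. Its continuity rests on Q_A \ Q_A Int(P) being mu-null: for
   s in Int(P) this set is disjoint from its right translate by s, and s can be
   chosen arbitrarily close to 1, so Steinhaus' theorem applies (to the inverse
   set, as null sets are stable under inversion by Fubini).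
   (2) follows from Q_A = A^-1.
   (3) For a compact Y with a Haar system, Y x| P is closed in Y x G, which makes
   y |-> Q_y upper semicontinuous, and its range map is open, which makes
   y |-> Q_y lower semicontinuous. Hence y |-> Q_y^-1 is continuous into the
   closed subsets of G; it maps y0 a to P^-1 a, so by (A2) it takes values in X
   and is onto X, and (A3) is its injectivity. *)
From HB Require Import structures.
From mathcomp Require Import all_boot all_order all_algebra finmap.
From mathcomp Require Import all_classical all_reals all_analysis.
From mathcomp Require Import measurable_realfun.
From mathcomp Require Import ring.
Require Import Defs.
Set Implicit Arguments.
Unset Strict Implicit.
Unset Printing Implicit Defensive.
Import Order.TTheory GRing.Theory Num.Theory.
Import numFieldNormedType.Exports.
Local Open Scope classical_set_scope.
Local Open Scope group_scope.

(** * Compactness *)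

Section compactness.
Context (T : topologicalType).

(** The obstacle in (1) is that two sides of [G] interfere. Groupoid composition acts on the sets
    [Q_A] by left translation, so a left Haar measure gives invariance; but [Q_A] absorbs [P] on the
    right, and the disjointness behind the null set concerns right translates, for which left
    invariance says nothing. Inversion turns them into left translates. The null set is exactly
    where continuity in [A] can fail. A point outside [Q_A] stays outside [Q_B] for [B] near [A]. A
    point [k p] with [k] in [Q_A] and [p] in [Int(P)] stays inside: [Q_B] contains some [k'] near
    [k], and [k'^-1 k p] is still in [P]. Nothing protects the remaining points, those of [Q_A]
    outside [Q_A Int(P)]. The identity [Q_A = A^-1] hides an existence claim: the arrow [(A, g)]
    needs the source [A g] in the compactification, although [g] need not lie in [P]. In (3) the
    Haar system acts as a detector: the integral of a bump function over the fibre at [z] vanishes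
    unless the fibre meets the support, and it varies continuously with [z]. *)

Lemma lc_compact_nbhs (hT : hausdorff_space T)
    (lcT : locally_compact [set: T]) (x : T) U :
  nbhs x U -> exists V, [/\ nbhs x V, compact V, closed V & V `<=` U].
Proof.
move=> Ux; have [K] := lcT x I; rewrite withinET => Kx [cK clK].
have [V Vx VU] := compact_regular hT cK Kx Ux.
exists (K `&` closure V); split.
- by apply: filterI => //; apply: filterS Vx; exact: subset_closure.
- by apply: compact_closedI => //; exact: closed_closure.
- by apply: closedI => //; exact: closed_closure.
- by move=> y [_ /VU].
Qed.

Lemma compact_finite_cover (K : set T) (U : T -> set T) : compact K ->
  (forall x, K x -> nbhs x (U x)) ->
  exists s : seq T, {in s, forall y, K y} /\
    K `<=` [set x | exists2 y, y \in s & U y x].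
Proof.
move=> /compact_near_coveringP cK KU.
pose ok (s : seq T) := {in s, forall y, K y}.
(* [F] is generated by the tails of the finite families in [K], ordered by inclusion: the
   near-covering form of compactness along it yields one family that is good for all of [K]. *)
pose F : set_system (seq T) := filter_from ok
  (fun s => [set t | ok t /\ {subset s <= t}]).
have FF : Filter F.
  apply: filter_from_filter; first by exists [::].
  move=> s t os ot; exists (s ++ t).
    by move=> y; rewrite mem_cat => /orP[/os|/ot].
  by move=> u [ou su]; split; split=> // y yst; apply: su;
    rewrite mem_cat yst ?orbT.
have [x Kx|s os sP] := cK _ F
    (fun s x => ok s -> exists2 y, y \in s & U y x) FF.
  exists (U x, [set s | ok s /\ {subset [:: x] <= s}]).
    split; first exact: KU.
    by exists [:: x] => // y; rewrite inE => /eqP ->.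
  move=> [y s] [/= Uxy [os xs]] _; exists x => //; apply: xs.
  by rewrite inE.
by exists s; split=> // x Kx; apply: (sP s) => //; split.
Qed.

Lemma compact_open_nbhs (hT : hausdorff_space T)
    (lcT : locally_compact [set: T]) (K U : set T) :
  compact K -> open U -> K `<=` U ->
  exists V, [/\ open V, K `<=` V, compact (closure V) & closure V `<=` U].
Proof.
move=> cK oU KU.
have pick x : exists V, K x -> [/\ nbhs x V, compact V, closed V & V `<=` U].
  have [Kx|nKx] := pselect (K x); last by exists set0.
  have Ux : nbhs x U by apply: open_nbhs_nbhs; split=> //; exact: KU.
  by have [V ?] := lc_compact_nbhs hT lcT Ux; exists V.
pose W x := sval (cid (pick x)).
have WP x : K x -> [/\ nbhs x (W x), compact (W x), closed (W x) & W x `<=` U].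
  exact: svalP (cid (pick x)).
have [|s [sK Ks]] := @compact_finite_cover K (fun x => (W x)°) cK.
  by move=> x /WP[Wx _ _ _]; exact: nbhs_interior.
pose L := \big[setU/set0]_(y <- s) W y.
have LE x : L x <-> exists2 y, y \in s & W y x.
  by rewrite /L -bigcup_seq; split=> -[y ys Wyx]; exists y.
have cL : compact L.
  rewrite /L big_seq; elim/big_ind : _ => //; first exact: compact0.
    by move=> A B; exact: compactU.
  by move=> y /sK /WP[].
have clL : closed L by exact: compact_closed.
have LU : L `<=` U by move=> x /LE[y /sK/WP[_ _ _ WU] /WU].
pose V := [set x | exists2 y, y \in s & (W y)° x].
have VL : closure V `<=` L.
  rewrite [X in _ `<=` X]((closure_id L).1 clL); apply: closureS.
  by move=> x [y ys /interior_subset Wyx]; apply/LE; exists y.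
exists V; split => //.
- rewrite (_ : V = \bigcup_(y in [set` s]) (W y)°)//.
  by apply: bigcup_open => y _; exact: open_interior.
- exact: (subclosed_compact (@closed_closure _ V) cL VL).
- exact: subset_trans LU.
Qed.

(** The compact set [K \ V] lies in [U] and has a neighbourhood [O] with closure in [U]; the cut is
    made along [O]. This gives subadditivity of the inner content on open sets. *)
Lemma compact_setU_split (hT : hausdorff_space T)
    (lcT : locally_compact [set: T]) (K U V : set T) :
  compact K -> open U -> open V -> K `<=` U `|` V ->
  exists K1 K2, [/\ compact K1, compact K2, K1 `<=` U, K2 `<=` V &
    K = K1 `|` K2].
Proof.
move=> cK oU oV KUV.
have cKV : compact (K `\` V).
  by apply: compact_closedI => //; exact: open_closedC.
have [|O [oO KO cO OU]] := compact_open_nbhs hT lcT cKV oU.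
  by move=> x [/KUV[]].
exists (K `&` closure O), (K `\` O); split.
- by apply: compact_closedI => //; exact: closed_closure.
- by apply: compact_closedI => //; exact: open_closedC.
- by move=> x [_ /OU].
- by move=> x [Kx nOx]; apply: contrapT => nVx; apply: nOx; exact: KO.
- apply/seteqP; split=> [x Kx|x [] []//].
  by have [Ox|nOx] := pselect (O x); [left; split=> //; exact: subset_closure
    |right].
Qed.

End compactness.

Lemma set_type_hausdorff (T : topologicalType) (S : set T) :
  hausdorff_space T -> hausdorff_space (set_type S).
Proof.
move=> hT x y clxy; apply: val_inj; apply: hT => U V xU yV.
have [z [Uz Vz]] := clxy _ _ (initial_continuous xU) (initial_continuous yV).
by exists (val z).
Qed.

Lemma prod_hausdorff (S T : topologicalType) :
  hausdorff_space S -> hausdorff_space T -> hausdorff_space (S * T)%type.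
Proof.
move=> hS hT [x y] [x' y'] cl; congr (_, _).
- apply: hS => U V xU x'V.
  have [z [Uz Vz]] := cl _ _ (cvg_fst (F := nbhs x) (G := nbhs y) xU)
    (cvg_fst (F := nbhs x') (G := nbhs y') x'V).
  by exists z.1.
- apply: hT => U V yU y'V.
  have [z [Uz Vz]] := cl _ _ (cvg_snd (F := nbhs x) (G := nbhs y) yU)
    (cvg_snd (F := nbhs x') (G := nbhs y') y'V).
  by exists z.2.
Qed.

Lemma compact_set_type (T : topologicalType) (S : set T) (C : set (set_type S)) :
  compact [set val c | c in C] -> compact C.
Proof.
move=> cC F PF FC.
have PF' : ProperFilter (val x @[x --> F]) by exact: fmap_proper_filter.
have [|_ [[c Cc <-] clc]] := cC (val x @[x --> F]) PF'.
  by apply: (@filterS _ F _ C _ _ FC) => x Cx; exists x.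
exists c; split=> // E N FE; rewrite nbhsE => -[_ [[V oV <-] /= Vc] VN].
have [|_ [[x Ex <-] Vx]] := clc [set val x | x in E] V _ (open_nbhs_nbhs (conj oV Vc)).
  by apply: (@filterS _ F _ E _ _ FE) => x Ex; exists x.
by exists x; split=> //; exact: VN.
Qed.

Lemma continuous_for_pair (S T U : topologicalType) (f : S -> T) (g : S -> U) x :
  {for x, continuous f} -> {for x, continuous g} ->
  {for x, continuous (fun t => (f t, g t))}.
Proof. by move=> cf cg; exact: cvg_pair. Qed.

Lemma compact_bijection_homeomorphism (S T : topologicalType) (f : S -> T) :
  compact [set: S] -> hausdorff_space T -> continuous f -> bijective f ->
  homeomorphism f.
Proof.
move=> cS hT cf [g fK gK]; split=> //; exists g; split=> //.
apply/continuous_closedP => A clA.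
rewrite (_ : g @^-1` A = f @` A); last first.
  apply/seteqP; split=> [y Ay|_ [x Ax <-]]; first by exists (g y).
  by rewrite /preimage /= fK.
apply: compact_closed => //; apply: continuous_compact.
  exact: continuous_subspaceT.
exact: subclosed_compact cS (@subsetT _ A).
Qed.

(** * Covering numbers and Haar measure *)

Lemma setVK (H : groupType) (A : set H) : setV (setV A) = A.
Proof.
apply/seteqP; split=> [_ [_ [x Ax <-] <-]|x Ax]; first by rewrite invgK.
by exists x^-1; rewrite ?invgK//; exists x.
Qed.

Section topological_group.
Context (G : topologicalGroupType).

Lemma mulgl_continuous (g : G) : continuous (fun x : G => g * x).
Proof.
move=> x.
apply: (@continuous_comp _ _ _ (fun x => (g, x)) (fun z => z.1 * z.2)).
  by apply: cvg_pair => //=; exact: cvg_cst.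
exact: mulg_continuous.
Qed.

Lemma mulVg_continuous : continuous (fun z : G * G => z.1^-1 * z.2).
Proof.
move=> z; apply: (@continuous_comp _ _ _ (fun z : G * G => (z.1^-1, z.2))
  (fun z => z.1 * z.2)); last exact: mulg_continuous.
apply: cvg_pair => /=; last exact: cvg_snd.
by apply: continuous_comp; [exact: cvg_fst | exact: invg_continuous].
Qed.

(** The left translate [g A], written as a preimage so that membership and openness need no
    witness. *)
Definition setMl (g : G) (A : set G) : set G := [set x | A (g^-1 * x)].

Lemma setMlE g A : setMl g A = [set g * x | x in A].
Proof.
apply/seteqP; split=> [x Ax|_ [x Ax <-]]; last by rewrite /setMl /= mulKg.
by exists (g^-1 * x) => //; rewrite mulVKg.
Qed.

Lemma setMlK g : cancel (setMl g) (setMl g^-1).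
Proof.
by move=> A; apply/seteqP; split=> x; rewrite /setMl /= invgK ?mulVKg ?mulKg.
Qed.

Lemma compact_setMl g A : compact A -> compact (setMl g A).
Proof.
move=> cA; rewrite setMlE; apply: continuous_compact => //.
by apply: continuous_subspaceT; exact: mulgl_continuous.
Qed.

Lemma open_setMl g A : open A -> open (setMl g A).
Proof.
by move=> oA; apply: open_comp => // x _; exact: mulgl_continuous.
Qed.

Lemma compact_invMg (K L : set G) : compact K -> compact L ->
  compact [set z.1^-1 * z.2 | z in K `*` L].
Proof.
move=> cK cL; apply: continuous_compact; last exact: compact_setX.
by apply: continuous_subspaceT; exact: mulVg_continuous.
Qed.

Lemma nbhs_mulgl (g x : G) U : nbhs (g * x) U -> nbhs x [set y | U (g * y)].
Proof. by move=> Ugx; exact: mulgl_continuous. Qed.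

(** The closed set [K^-1 L] does not contain 1, so it is disjoint from [V^-1 V] for small [V]; a
    translate [g V] containing both [x] and [y] would put [x^-1 y] in both sets. *)
Lemma compact_separation (hG : hausdorff_space G) (K L : set G) :
  compact K -> compact L -> K `&` L = set0 ->
  exists2 U, nbhs (1 : G) U & forall V, V `<=` U -> forall g x y,
    K x -> L y -> V (g^-1 * x) -> V (g^-1 * y) -> False.
Proof.
move=> cK cL KL0; pose D := [set z.1^-1 * z.2 | z in K `*` L].
have clD : closed D by apply: compact_closed => //; exact: compact_invMg.
have nD1 : (~` D) (1^-1 * 1).
  rewrite invg1 mulg1 => -[[x y] /= [Kx Ly] /eqP].
  rewrite -(inj_eq (mulgI x)) mulgA mulgV mul1g mulg1 => /eqP xy.
  by have : (K `&` L) x by [split=> //; rewrite -xy]; rewrite KL0.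
have := @mulVg_continuous (1, 1) (~` D); rewrite /= nbhs_filterE.
case; first by apply: open_nbhs_nbhs; split => //; exact: closed_openC.
move=> [A B] /= [A1 B1] ABD; exists (A `&` B); first exact: filterI.
move=> V VAB g x y Kx Ly /VAB[Ax _] /VAB[_ By].
apply: (ABD (g^-1 * x, g^-1 * y)) => //=; exists (x, y) => //=.
by rewrite invgM invgK -mulgA mulVKg.
Qed.

End topological_group.

Section covering_number.
Context (G : topologicalGroupType).
Implicit Types K L V : set G.

Definition covers K V n := exists s : seq G, (size s <= n)%N /\
  K `<=` [set x | exists2 g, g \in s & V (g^-1 * x)].

(** Haar's covering index [(K : V)], with default 0 when finitely many translates never suffice. *)
Definition cov K V : nat :=
  match pselect (exists n, `[< covers K V n >]) with
  | left e => ex_minn e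
  | right _ => 0%N
  end.

Lemma covP K V n : covers K V n -> covers K V (cov K V).
Proof.
move=> KVn; rewrite /cov; case: pselect => [e|[]]; last first.
  by exists n; exact/asboolP.
by case: ex_minnP => m /asboolP.
Qed.

Lemma cov_le K V n : covers K V n -> (cov K V <= n)%N.
Proof.
move=> /asboolP KVn; rewrite /cov; case: pselect => [e|[]]; last by exists n.
by case: ex_minnP => m _; apply.
Qed.

Lemma compact_covers K V : compact K -> nbhs (1 : G) V -> covers K V (cov K V).
Proof.
move=> cK V1; have [|s [_ Ks]] := @compact_finite_cover _ K
    (fun g => [set x | V (g^-1 * x)]) cK.
  by move=> g _; apply: nbhs_mulgl; rewrite mulVg.
by apply: (@covP _ _ (size s)); exists s.
Qed.

Lemma cov0 V : cov set0 V = 0%N.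
Proof. by apply/eqP; rewrite -leqn0; apply: cov_le; exists [::]; split=> // x. Qed.

Lemma covS K L V : compact L -> nbhs (1 : G) V -> K `<=` L ->
  (cov K V <= cov L V)%N.
Proof.
move=> cL V1 KL; have [s [sn Ls]] := compact_covers cL V1.
by apply: cov_le; exists s; split=> //; exact: subset_trans Ls.
Qed.

Lemma covU K L V : compact K -> compact L -> nbhs (1 : G) V ->
  (cov (K `|` L) V <= cov K V + cov L V)%N.
Proof.
move=> cK cL V1.
have [s [sn Ks]] := compact_covers cK V1.
have [t [tn Lt]] := compact_covers cL V1.
apply: cov_le; exists (s ++ t); split; first by rewrite size_cat leq_add.
by move=> x [/Ks|/Lt] [g gs gx]; exists g => //; rewrite mem_cat gs ?orbT.
Qed.

(** No translate of [V] meets both sets, so a minimal cover of the union splits into the translates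
    that meet [K] and those that do not. *)
Lemma covU_separated K L V : compact K -> compact L -> nbhs (1 : G) V ->
  (forall g x y, K x -> L y -> V (g^-1 * x) -> V (g^-1 * y) -> False) ->
  cov (K `|` L) V = (cov K V + cov L V)%N.
Proof.
move=> cK cL V1 sep; apply/eqP; rewrite eqn_leq covU//=.
have [s [sn KLs]] := compact_covers (compactU cK cL) V1.
apply: leq_trans sn.
pose p := fun g : G => `[< exists2 x, K x & V (g^-1 * x) >].
rewrite -(count_predC p s) -!size_filter; apply: leq_add; apply: cov_le.
- exists (seq.filter p s); split=> // x Kx; have [|g gs gx] := KLs x; first by left.
  by exists g => //; rewrite mem_filter gs andbT; apply/asboolP; exists x.
- exists (seq.filter (predC p) s); split=> // y Ly.
  have [|g gs gy] := KLs y; first by right.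
  exists g => //; rewrite mem_filter gs andbT /=; apply/asboolPn => -[x Kx gx].
  exact: (sep g x y).
Qed.

Lemma covers_setMl K V n g : covers K V n -> covers (setMl g K) V n.
Proof.
move=> [s [sn Ks]]; exists [seq g * h | h <- s]; split; first by rewrite size_map.
move=> x /Ks[h hs hx]; exists (g * h); first by apply/mapP; exists h.
by rewrite invgM -mulgA.
Qed.

Lemma cov_setMl K V g : cov (setMl g K) V = cov K V.
Proof.
have covE n : covers (setMl g K) V n <-> covers K V n.
  split; last exact: covers_setMl.
  by move=> Kn; rewrite -(setMlK g K); exact: covers_setMl.
have le A B : (forall n, covers B V n -> covers A V n) ->
    (exists n, covers B V n) -> (cov A V <= cov B V)%N.
  by move=> AB [n /covP BV]; exact/cov_le/AB.
have [[n Kn]|nK] := pselect (exists n, covers K V n).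
  apply/eqP; rewrite eqn_leq; apply/andP; split; apply: le.
  - by move=> m /covE.
  - by exists n.
  - by move=> m /covE.
  - by exists n; exact/covE.
(* Without a finite cover of [K] there is none of its translate either, and both sides take the
   default 0. *)
rewrite /cov; case: pselect => [e|_].
  by have [n /asboolP/covE Kn] := e; case: nK; exists n.
by case: pselect => // e; have [n /asboolP Kn] := e; case: nK; exists n.
Qed.

(** Taking the reference set for [L], this bounds the normalised index of [K] uniformly in [V]. *)
Lemma cov_trans K L V : compact K -> compact L -> nbhs (1 : G) L ->
  nbhs (1 : G) V -> (cov K V <= cov K L * cov L V)%N.
Proof.
move=> cK cL L1 V1.
have [s [sn Ks]] := compact_covers cK L1.
have [t [tn Lt]] := compact_covers cL V1.
apply: cov_le; exists [seq g * h | g <- s, h <- t]; split.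
  by rewrite size_allpairs leq_mul.
move=> x /Ks[g gs /Lt[h ht hx]]; exists (g * h); first exact: allpairs_f.
by rewrite invgM -mulgA.
Qed.

Lemma cov_gt0 K V : compact K -> nbhs (1 : G) V -> K !=set0 -> (0 < cov K V)%N.
Proof.
move=> cK V1 [x Kx]; have [s [sn Ks]] := compact_covers cK V1.
by apply: leq_trans sn; have [g] := Ks _ Kx; case: s {Ks}.
Qed.

End covering_number.

Section limits.
Context (R : realType).
Local Open Scope ring_scope.

(** An ultrafilter decides every neighbourhood of a cluster point, so clustering is already
    convergence. *)
Lemma ultra_bounded_cvg (T : Type) (F : set_system T) (f : T -> R) (a b : R) :
  UltraFilter F -> F [set t | a <= f t <= b] ->
  exists2 l, a <= l <= b & f x @[x --> F] --> l.
Proof.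
move=> UF Fab; pose H : set_system R := f x @[x --> F].
have PH : ProperFilter H by exact: fmap_proper_filter.
have [|l [/= lab cl]] := @segment_compact R a b H PH.
  by rewrite /H nbhs_filterE /=; apply: filterS Fab => t; rewrite /= in_itv.
exists l; first by rewrite in_itv in lab.
move=> U lU; have [//|FnU] := in_ultra_setVsetC (f @^-1` U) UF.
have [|x []] := cl (~` U) U _ lU; last by [].
by rewrite /H nbhs_filterE.
Qed.

Lemma le_cvg_filter (T : Type) (F : set_system T) (f g : T -> R) (l m : R) :
  ProperFilter F -> f x @[x --> F] --> l -> g x @[x --> F] --> m ->
  (\forall x \near F, f x <= g x) -> l <= m.
Proof.
move=> PF fl gm fg; rewrite -subr_ge0.
apply: (@closed_cvg _ _ F PF (g - f) [set x | 0 <= x]).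
- exact: closed_ge.
- by apply: filterS fg => t; rewrite /= fctE subr_ge0.
- exact: cvgB.
Qed.

End limits.

(** * Haar content as a limit of normalised covering indices *)

Section haar_content.
Context (R : realType) (G : topologicalGroupType).
Local Open Scope ring_scope.

Record is_haar_content (lam : set G -> R) : Prop := {
  content_ge0 : forall K, compact K -> 0 <= lam K;
  content0 : lam set0 = 0;
  contentS : forall K L, compact K -> compact L -> K `<=` L -> lam K <= lam L;
  contentU_le : forall K L, compact K -> compact L ->
    lam (K `|` L) <= lam K + lam L;
  contentU : forall K L, compact K -> compact L -> K `&` L = set0 ->
    lam (K `|` L) = lam K + lam L;
  content_setMl : forall g K, compact K -> lam (setMl g K) = lam K;
  content_gt0 : exists2 K, compact K & 0 < lam K
}.

(** Haar's construction: the limit of [(K : V) / (K0 : V)] as [V] shrinks to 1. An ultrafilter [F]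
    finer than the small neighbourhoods of 1 makes the limit exist for all compact [K] at once;
    inequalities pass to it, and so does additivity, which holds for all small enough [V]. The ratio
    of [K0] is constantly 1, so the limit is not zero. *)
Lemma haar_content_exists : hausdorff_space G -> locally_compact [set: G] ->
  exists lam, is_haar_content lam.
Proof.
move=> hG lcG.
have [K0 [K01 cK0 _ _]] := lc_compact_nbhs hG lcG (@filterT _ (nbhs (1%g : G)) _).
have [F [UF smallF]] := ultraFilterLemma
  (powerset_filter_from_filter (nbhs_pfilter (1%g : G))).
have PF : ProperFilter F by exact: ultra_proper.
have F1 : \forall V \near F, nbhs (1%g : G) V.
  by apply: smallF; exact: near_small_set.
pose ratio K V : R := (cov K V)%:R / (cov K0 V)%:R.
have posK0 V : nbhs (1%g : G) V -> 0 < (cov K0 V)%:R :> R.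
  move=> V1; rewrite ltr0n; apply: cov_gt0 => //.
  by exists 1%g; exact: nbhs_singleton.
have cvgK K : compact K -> exists2 l : R, 0 <= l & ratio K V @[V --> F] --> l.
  move=> cK.
  have [|l /andP[l0 _] cvl] :=
      @ultra_bounded_cvg R _ F (ratio K) 0 (cov K K0)%:R UF.
    apply: filterS F1 => V V1 /=; apply/andP; split.
      by rewrite divr_ge0.
    rewrite ler_pdivrMr ?posK0// -natrM ler_nat.
    exact: cov_trans.
  by exists l.
pose lam K : R := lim (ratio K V @[V --> F]).
have lamP K : compact K -> ratio K V @[V --> F] --> lam K.
  by move=> /cvgK[l _ cl]; apply/cvg_ex; exists l.
exists lam; split.
- move=> K cK; apply: limr_ge; first exact: lamP.
  by apply: nearW => V; rewrite divr_ge0.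
- apply: (cvg_unique (@Rhausdorff R) (lamP _ compact0)).
  rewrite (_ : ratio set0 = cst 0); first exact: cvg_cst.
  by apply/funext => V; rewrite /ratio cov0 mul0r.
- move=> K L cK cL KL; apply: le_cvg_filter (lamP _ cK) (lamP _ cL) _.
  apply: filterS F1 => V V1; rewrite ler_pM2r ?invr_gt0 ?posK0// ler_nat.
  exact: covS.
- move=> K L cK cL.
  apply: le_cvg_filter (lamP _ (compactU cK cL)) (cvgD (lamP _ cK) (lamP _ cL)) _.
  apply: filterS F1 => V V1; rewrite /= /ratio -[leRHS]mulrDl -natrD.
  by rewrite ler_pM2r ?invr_gt0 ?posK0// ler_nat covU.
- move=> K L cK cL KL0.
  apply: (cvg_unique (@Rhausdorff R) (lamP _ (compactU cK cL))).
  have [U U1 sep] := compact_separation hG cK cL KL0.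
  have FU : \forall V \near F, V `<=` U by apply: smallF; exact: small_set_sub.
  apply: cvg_trans (cvgD (lamP _ cK) (lamP _ cL)).
  apply: near_eq_cvg; apply: filterS2 F1 FU => V V1 VU /=.
  rewrite [LHS]/GRing.add /= /ratio -mulrDl -natrD covU_separated//.
  exact: sep.
- move=> g K cK; rewrite /lam (_ : ratio (setMl g K) = ratio K)//.
  by apply/funext => V; rewrite /ratio cov_setMl.
- exists K0 => //; rewrite (_ : lam K0 = 1)//.
  apply: (cvg_unique (@Rhausdorff R) (lamP _ cK0)).
  apply: cvg_near_cst; apply: filterS F1 => V /posK0 V0.
  by rewrite /ratio divff// gt_eqF.
Qed.

End haar_content.

(* borelType requires a pointed space. *)
#[non_forgetful_inheritance]
HB.instance Definition _ (G : topologicalGroupType) := isPointed.Build G 1.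

(** * From a Haar content to a Borel measure *)

Section content_to_measure.
Context (R : realType) (G : topologicalGroupType).
Hypotheses (hG : hausdorff_space G) (lcG : locally_compact [set: G]).
Variable lam : set G -> R.
Hypothesis hlam : is_haar_content lam.
Local Open Scope ereal_scope.

(** The usual regularisation of a content: open sets are measured from inside by compact sets, and
    [content_outer] measures all sets from outside by open ones. On a compact set the result may
    exceed [lam]. *)
Definition content_inner (U : set G) : \bar R :=
  ereal_sup [set (lam K)%:E | K in [set K | compact K /\ K `<=` U]].

Definition content_outer (A : set G) : \bar R :=
  ereal_inf [set content_inner U | U in [set U | open U /\ A `<=` U]].

Local Notation inner := content_inner.
Local Notation outer := content_outer.

Lemma inner_ge K U : compact K -> K `<=` U -> (lam K)%:E <= inner U.
Proof. by move=> cK KU; apply: ereal_sup_ubound; exists K. Qed.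

Lemma inner_ge0 U : 0 <= inner U.
Proof.
have := @inner_ge set0 U compact0 (@sub0set _ U); by rewrite (content0 hlam).
Qed.

Lemma innerS U V : U `<=` V -> inner U <= inner V.
Proof.
move=> UV; apply: ge_ereal_sup => _ [K [cK KU] <-]; apply: inner_ge => //.
exact: subset_trans UV.
Qed.

Lemma inner_setMl g U : inner (setMl g U) = inner U.
Proof.
have le h V : inner V <= inner (setMl h V).
  apply: ge_ereal_sup => _ [K [cK KV] <-]; rewrite -(content_setMl hlam h)//.
  by apply: inner_ge; [exact: compact_setMl | move=> x /KV].
by apply/eqP; rewrite eq_le le -{2}(setMlK g U) le.
Qed.

(** Induction on [n]: [compact_setU_split] cuts off the part of [K] that lies in the last open
    set. *)
Lemma inner_bigcup_ord (U : nat -> set G) n K : (forall i, open (U i)) ->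
  compact K -> K `<=` \bigcup_(i < n) U i ->
  (lam K)%:E <= \sum_(0 <= i < n) inner (U i).
Proof.
move=> oU; elim: n K => [|n IH] K cK.
  rewrite big_nil bigcup_mkord big_ord0 subset0 => ->.
  by rewrite (content0 hlam).
rewrite bigcup_mkord big_ord_recr/= -bigcup_mkord => KU.
have oV : open (\bigcup_(i < n) U i) by exact: bigcup_open.
have [K1 [K2 [cK1 cK2 K1U K2U ->]]] := compact_setU_split hG lcG cK oV (oU n) KU.
rewrite big_nat_recr//=.
apply: (@le_trans _ _ ((lam K1)%:E + (lam K2)%:E)).
  by rewrite -EFinD lee_fin contentU_le.
by apply: leeD; [exact: IH | exact: inner_ge].
Qed.

Lemma inner_bigcup (U : nat -> set G) : (forall i, open (U i)) ->
  inner (\bigcup_i U i) <= \sum_(i <oo) inner (U i).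
Proof.
move=> oU; apply: ge_ereal_sup => _ [K [cK KU] <-].
have /compact_near_coveringP covK := cK.
have [|N _ NK] := covK nat \oo (fun n x => (\bigcup_(i < n) U i) x) _.
  move=> x /KU[i _ Uix]; exists (U i, [set n | (i < n)%N]).
    split; last by exists i.+1.
    by apply: open_nbhs_nbhs; split; [exact: oU|].
  by move=> [y n] /= [Uiy i_n]; exists i.
have KN : K `<=` \bigcup_(i < N) U i by apply: NK => /=.
apply: le_trans (inner_bigcup_ord oU cK KN) _.
by apply: nneseries_lim_ge => n _ _; exact: inner_ge0.
Qed.

Lemma outer_le U A : open U -> A `<=` U -> outer A <= inner U.
Proof. by move=> oU AU; apply: ereal_inf_lbound; exists U. Qed.

Lemma outer_open U : open U -> outer U = inner U.
Proof.
move=> oU; apply/eqP; rewrite eq_le outer_le//=.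
by apply: le_ereal_inf_tmp => _ [V [oV UV] <-]; exact: innerS.
Qed.

Lemma outer_ge0 A : 0 <= outer A.
Proof. by apply: le_ereal_inf_tmp => _ [V _ <-]; exact: inner_ge0. Qed.

Lemma outer0 : outer set0 = 0.
Proof.
rewrite outer_open; last exact: open0.
apply/eqP; rewrite eq_le inner_ge0 andbT; apply: ge_ereal_sup => _ [K [_ K0] <-].
by move: K0; rewrite subset0 => ->; rewrite (content0 hlam).
Qed.

Lemma outerS A B : A `<=` B -> outer A <= outer B.
Proof.
move=> AB; apply: le_ereal_inf_tmp => _ [V [oV BV] <-]; apply: outer_le => //.
exact: subset_trans BV.
Qed.

Lemma outer_lt A x : outer A < x ->
  exists U, [/\ open U, A `<=` U & outer U < x].
Proof.
move=> /ereal_inf_lt[_ [U [oU AU] <-] Ux]; exists U; split=> //.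
by rewrite outer_open.
Qed.

Lemma outer_sigma_subadditive : sigma_subadditive outer.
Proof.
move=> A; have [[i ioo]|] := pselect (exists i, outer (A i) = +oo).
  rewrite (eseries_pinfty _ _ ioo) ?leey// => n _.
  by rewrite -ltNye (lt_le_trans _ (outer_ge0 _)).
rewrite -forallNE => Aoo.
apply/lee_addgt0Pr => e e0.
rewrite (le_trans _ (epsilon_trick _ _ _))//; last 2 first.
  by move=> n; exact: outer_ge0.
  exact: ltW.
pose Q n U := [/\ open U, A n `<=` U &
  outer U < outer (A n) + (e / (2 ^ n.+1)%:R)%:E].
have [U UP] : {U : nat -> set G & forall n, Q n (U n)}.
  apply: (@choice _ _ Q) => n; apply: outer_lt.
  rewrite lteDl ?lte_fin ?divr_gt0// ge0_fin_numE ?outer_ge0//.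
  by rewrite ltey; apply/eqP; exact: Aoo.
have oU n : open (U n) by have [] := UP n.
apply: (@le_trans _ _ (outer (\bigcup_n U n))).
  by apply: outerS; apply: subset_bigcup => n _; have [] := UP n.
rewrite outer_open; last exact: bigcup_open.
apply: le_trans (inner_bigcup oU) _.
apply: lee_nneseries => n *; first exact: inner_ge0.
by rewrite -outer_open// ltW//; have [] := UP n.
Qed.

HB.instance Definition _ := isOuterMeasure.Build R G outer
  outer0 outer_ge0 outerS outer_sigma_subadditive.

(** Exhaust [V] within [U] by compact sets [K], then the open set [V \ K], which contains [V \ U],
    by compact sets [L]. As [K] and [L] are disjoint, [lam] is additive on them, and their union
    lies in [V]. *)
Lemma inner_split U V : open U -> open V ->
  inner (V `&` U) + outer (V `\` U) <= inner V.
Proof.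
move=> oU oV.
(* The suprema are reached by moving terms across the inequality, which needs finite values. *)
have [->|Vfin] := eqVneq (inner V) +oo; first by rewrite leey.
have fV : inner V \is a fin_num by rewrite ge0_fin_numE ?inner_ge0// ltey.
have key K : compact K -> K `<=` V `&` U ->
    (lam K)%:E + outer (V `\` U) <= inner V.
  move=> cK KVU; have clK : closed K by exact: compact_closed.
  have oVK : open (V `\` K) by apply: openI => //; exact: closed_openC.
  apply: (@le_trans _ _ ((lam K)%:E + inner (V `\` K))).
    by rewrite leeD2l// outer_le// => x [Vx nUx]; split=> // /KVU[].
  rewrite -leeBrDl//; apply: ge_ereal_sup => _ [L [cL LVK] <-].
  rewrite leeBrDl// -EFinD -(contentU hlam)//; last first.
    by rewrite -subset0 => x [Kx /LVK[]].
  apply: inner_ge; first exact: compactU.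
  by move=> x [/KVU[]|/LVK[]].
have fO : outer (V `\` U) \is a fin_num.
  rewrite ge0_fin_numE ?outer_ge0//; apply: le_lt_trans (_ : inner V < +oo).
    by apply: outer_le => // x [].
  by rewrite ltey.
rewrite -leeBrDr//; apply: ge_ereal_sup => _ [K [cK KVU] <-].
by rewrite leeBrDr//; exact: key.
Qed.

Lemma open_caratheodory U : open U -> outer.-caratheodory U.
Proof.
move=> oU; apply: le_caratheodory_measurable => A /=.
apply: le_ereal_inf_tmp => _ [V [oV AV] <-].
apply: le_trans (inner_split oU oV); apply: leeD.
- by apply: outer_le; [exact: openI | exact: setSI].
- by apply: outerS; exact: setSI.
Qed.

Lemma borel_caratheodory (A : set (borelType G)) :
  measurable A -> outer.-caratheodory A.
Proof.
apply: smallest_sub; last exact: open_caratheodory.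
split.
- exact: (caratheodory_measurable_set0 outer).
- by move=> B cB; rewrite setTD; exact: (caratheodory_measurable_setC cB).
- by move=> B cB; exact: (caratheodory_measurable_bigcup cB).
Qed.

Lemma outer_setMl g A : outer (setMl g A) = outer A.
Proof.
have le h B : outer (setMl h B) <= outer B.
  apply: le_ereal_inf_tmp => _ [V [oV BV] <-]; rewrite -(inner_setMl h).
  by apply: outer_le; [exact: open_setMl | move=> x /BV].
by apply/eqP; rewrite eq_le le /= -{1}(setMlK g A) le.
Qed.

Lemma outer_compact K : compact K -> outer K < +oo.
Proof.
move=> cK; have [U [oU KU cU _]] := compact_open_nbhs hG lcG cK openT (@subsetT _ K).
apply: le_lt_trans (outer_le oU KU) _.
apply: (@le_lt_trans _ _ (lam (closure U))%:E); last exact: ltry.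
apply: ge_ereal_sup => _ [L [cL LU] <-]; rewrite lee_fin.
by apply: (contentS hlam) => //; apply: subset_trans LU _; exact: subset_closure.
Qed.

(** A compact neighbourhood of content 0 inside [U] would give content 0 to every compact set, since
    finitely many translates of it cover that set. *)
Lemma outer_open_gt0 U : open U -> U !=set0 -> 0 < outer U.
Proof.
move=> oU [x Ux]; rewrite outer_open//.
have [V [Vx cV _ VU]] := lc_compact_nbhs hG lcG (open_nbhs_nbhs (conj oU Ux)).
apply: lt_le_trans (inner_ge cV VU); rewrite lte_fin lt_neqAle content_ge0//.
rewrite andbT eq_sym; apply/eqP => V0.
have [K cK] := content_gt0 hlam; rewrite ltNge => /negP; apply.
pose W : set G := [set g | V (x * g)%g].
have W1 : nbhs (1%g : G) W by apply: nbhs_mulgl; rewrite mulg1.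
have WE g : setMl g W = setMl (g * x^-1)%g V.
  by apply/seteqP; split=> y; rewrite /setMl /W /= invgM invgK -mulgA.
have [s [_ Ks]] := compact_covers cK W1.
have cW g : compact (setMl g W) by rewrite WE; exact: compact_setMl.
have lW g : lam (setMl g W) = 0%R by rewrite WE content_setMl.
suff [cU U0] : compact (\big[setU/set0]_(g <- s) setMl g W) /\
    (lam (\big[setU/set0]_(g <- s) setMl g W) <= 0)%R.
  apply: le_trans U0; apply: (contentS hlam) => // y /Ks[g gs Wy].
  by rewrite -bigcup_seq; exists g.
elim/big_ind : _ => [|A B [cA A0] [cB B0]|g _].
- by split; [exact: compact0 | rewrite (content0 hlam)].
- split; first exact: compactU.
  apply: le_trans (contentU_le hlam cA cB) _.
  by rewrite -[leRHS]addr0 lerD.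
- by split=> //; rewrite lW.
Qed.

Lemma outer_borel_sigma_additive :
  semi_sigma_additive (outer : set (borelType G) -> \bar R).
Proof.
move=> F mF tF mUF.
by apply: (@caratheodory_measure_sigma_additive R G outer) => //;
  [move=> n|]; exact: borel_caratheodory.
Qed.

(** A second name for [content_outer], to carry the structure of a measure on the Borel sets besides
    that of an outer measure. *)
Definition borel_outer : set (borelType G) -> \bar R := outer.

HB.instance Definition _ := isMeasure.Build _ (borelType G) R borel_outer
  outer0 outer_ge0 outer_borel_sigma_additive.

Definition haar_outer : {measure set (borelType G) -> \bar R}%R := borel_outer.

End content_to_measure.

Section haar_measure.
Context (R : realType) (G : topologicalGroupType).
Local Open Scope ereal_scope.

(** Invariance and outer regularity are stated for arbitrary subsets: the measure constructed above
    is the restriction of an outer measure, whose values on all sets are kept. *)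
Record is_haar_measure (mu : {measure set (borelType G) -> \bar R}%R) : Prop := {
  haar_setMl : forall g (A : set G), mu (setMl g A) = mu A;
  haar_compact : forall K : set G, compact K -> mu K < +oo;
  haar_open : forall U : set G, open U -> U !=set0 -> 0 < mu U;
  haar_outer_regular : forall (A : set G) x, mu A < x ->
    exists U : set G, [/\ open U, A `<=` U & mu U < x]
}.

Lemma haar_measure_exists :
  hausdorff_space G -> locally_compact [set: G] ->
  exists mu, is_haar_measure mu.
Proof.
move=> hG lcG; have [lam hlam] := @haar_content_exists R G hG lcG.
exists (haar_outer hG lcG hlam); split.
- by move=> g A; exact: outer_setMl.
- by move=> K; exact: outer_compact.
- by move=> U; exact: outer_open_gt0.
- by move=> A x; exact: outer_lt.
Qed.

End haar_measure.

(** * Haar null sets *)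

Section borel.
Context (T : ptopologicalType).

Lemma open_borel (U : set T) : open U -> measurable (U : set (borelType T)).
Proof. by move=> oU; exact: sub_sigma_algebra. Qed.

Lemma closed_borel (A : set T) : closed A -> measurable (A : set (borelType T)).
Proof.
move=> cA; rewrite -(setCK A); apply: measurableC.
by apply: open_borel; exact: closed_openC.
Qed.

Lemma compact_borel (K : set T) : hausdorff_space T -> compact K ->
  measurable (K : set (borelType T)).
Proof. by move=> hT cK; apply: closed_borel; exact: compact_closed. Qed.

(** Fubini's theorem lives on the product of the Borel sigma-algebras; a countable basis makes [W] a
    countable union of open rectangles, so that it belongs there. *)
Lemma open_prod_measurable (W : set (T * T)) : @second_countable T -> open W ->
  measurable (W : set (borelType T * borelType T)).
Proof.
move=> [B cB [oB nB]] oW.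
have [f fB] : exists f : nat -> set T, forall U, B U -> exists n, f n = U.
  move/pfcard_geP : cB => [->|[f]]; first by exists (fun=> set0).
  by exists f => U /(@surj _ _ _ _ f)[n _ fn]; exists n.
rewrite (_ : W = \bigcup_n \bigcup_m
    (if `[< f n `*` f m `<=` W /\ (open (f n) /\ open (f m)) >]
     then f n `*` f m else set0)).
  apply: bigcupT_measurable => n; apply: bigcupT_measurable => m.
  case: asboolP => [[_ [on om]]|_]; last exact: measurable0.
  by apply: measurableX; exact: open_borel.
apply/seteqP; split=> [[x y] Wxy|z [n _ [m _]]]; last first.
  by case: asboolP => // -[+ _] => /[apply].
have [[U V] /= [Ux Vy] UVW] : nbhs (x, y) W by exact: open_nbhs_nbhs.
have [U' [BU' U'x] U'U] := nB x U Ux; have [V' [BV' V'y] V'V] := nB y V Vy.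
have [n fn] := fB _ BU'; have [m fm] := fB _ BV'.
exists n => //; exists m => //; rewrite fn fm asboolT//.
split; last by split; exact: oB.
by move=> [u v] /= [/U'U Uu /V'V Vv]; exact: (UVW (u, v)).
Qed.

End borel.

Section haar_null.
Context (R : realType) (G : topologicalGroupType).
Hypotheses (hG : hausdorff_space G) (lcG : locally_compact [set: G]).
Hypothesis scG : @second_countable G.
Variable mu : {measure set (borelType G) -> \bar R}%R.
Hypothesis hmu : is_haar_measure mu.
Local Open Scope ereal_scope.

Lemma setV_compact (K : set G) : compact K -> compact (setV K).
Proof.
move=> cK; apply: continuous_compact => //; apply: continuous_subspaceT.
exact: invg_continuous.
Qed.

(** Fubini for [S], the pairs with [x^-1 y] in [K]. Its sections at fixed [x] are the null sets
    [x K], those at fixed [y] are [y K^-1], of measure [mu (setV K)]. Restricting [y] to a compact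
    neighbourhood [C] of 1 and [x] to [D = C K^-1] makes both measures finite and cuts nothing off
    [y K^-1] for [y] in [C]. *)
Lemma haar_null_setV (K : set G) : compact K -> mu K = 0 -> mu (setV K) = 0.
Proof.
move=> cK K0.
have [C [C1 cC _ _]] := lc_compact_nbhs hG lcG (@filterT _ (nbhs (1%g : G)) _).
have cVK : compact (setV K) by exact: setV_compact.
pose D := [set z.1^-1%g * z.2 | z in setV C `*` setV K]%g.
have cD : compact D by apply: compact_invMg => //; exact: setV_compact.
have mC := compact_borel hG cC; have mD := compact_borel hG cD.
pose m1 : {finite_measure set (borelType G) -> \bar R}%R :=
  mfrestr mD (haar_compact hmu cD).
pose m2 : {finite_measure set (borelType G) -> \bar R}%R :=
  mfrestr mC (haar_compact hmu cC).
pose S : set (borelType G * borelType G) := [set z : G * G | K (z.1^-1 * z.2)]%g.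
have mS : measurable S.
  rewrite -(setCK S); apply: measurableC; apply: (open_prod_measurable scG).
  apply: closed_openC; apply: (@preimage_closed _ _ (fun z : G * G => z.1^-1 * z.2)%g).
    by move=> z _; exact: mulVg_continuous.
  exact: compact_closed.
have S0 : (m1 \x^ m2) S = 0.
  rewrite -(@product_measure_unique _ _ _ _ _ m1 m2 _ _ S mS)//; last first.
    by move=> A B mA mB; exact: product_measure2E.
  apply: integral0_eq => x _ /=; rewrite /m2 /= /mfrestr /mrestr.
  apply/eqP; rewrite eq_le measure_ge0 andbT.
  have <- : mu (setMl x K) = 0 by rewrite (haar_setMl hmu).
  apply: le_measure; rewrite ?inE.
  - by apply: measurableI => //; exact: measurable_xsection.
  - by apply: (compact_borel hG); exact: compact_setMl.
  - by move=> y [/xsectionP].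
have mS1 := measurable_fun_ysection m1 mS.
(* Integrating in the other order bounds this product by the measure of [S], which is 0; then [mu C]
   is positive. *)
have : mu (setV K) * mu C <= 0.
  rewrite -S0 /product_measure2.
  have -> : mu (setV K) * mu C = \int[m2]_(y in C) (cst (mu (setV K))) y.
    by rewrite integral_cst//= /m2 /mfrestr /mrestr setIid.
  apply: (@le_trans _ _ (\int[m2]_(y in C) (m1 \o ysection S) y)); last first.
    apply: ge0_subset_integral => //.
  apply: ge0_le_integral => //.
    exact: measurable_funTS.
  move=> y Cy; rewrite /m1 /= /mfrestr /mrestr -(haar_setMl hmu y).
  apply: le_measure; rewrite ?inE.
  - by apply: (compact_borel hG); exact: compact_setMl.
  - by apply: measurableI => //; exact: measurable_ysection.
  move=> x [k Kk kE].
  have xE : x = (y * k^-1)%g by rewrite kE mulVKg.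
  split; first by apply/ysectionP; rewrite /S /= xE invgM invgK mulgVK.
  exists (y^-1, k^-1)%g; last by rewrite /= invgK.
  by split; [exists y | exists k].
rewrite pmule_lle0; last first.
  apply: (@lt_le_trans _ _ (mu C°)).
    by apply: (haar_open hmu); [exact: open_interior | exists 1%g].
  apply: le_measure; rewrite ?inE//; last exact: interior_subset.
  by apply: open_borel; exact: open_interior.
by move=> VK0; apply/eqP; rewrite eq_le VK0 measure_ge0.
Qed.

(* Steinhaus: a set of positive measure meets its small translates. *)
Lemma haar_null_translates (E : set G) (S : set G) :
  compact E -> closure S 1%g -> (forall s, S s -> E `&` setMl s^-1%g E = set0) ->
  mu E = 0.
Proof.
move=> cE S1 disj; apply/eqP; rewrite eq_le measure_ge0 andbT leNgt.
apply/negP => E0.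
have Efin : mu E \is a fin_num.
  by rewrite ge0_fin_numE ?measure_ge0//; exact: haar_compact.
(* [U] is too small to hold two disjoint copies of [E], yet for [s] in [S] close to 1 it contains
   both [E] and [s^-1 E]. *)
have [|U [oU EU UE]] := @haar_outer_regular _ _ _ hmu E (mu E + mu E).
  by rewrite lteDl.
have /compact_near_coveringP covE := cE.
have near1 : \forall s \near (1%g : G), E `<=` [set x | U (s^-1 * x)%g].
  apply: covE => x Ex; have Ux : nbhs (1^-1 * x)%g U.
    by rewrite invg1 mul1g; apply: open_nbhs_nbhs; split=> //; exact: EU.
  have [[A B] /= [A1 Bx] ABU] := @mulVg_continuous G (1%g, x) U Ux.
  by exists (B, A) => // -[y s] [/= By As]; exact: (ABU (s, y)).
have [s [Ss sU]] := S1 _ near1.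
move: UE; rewrite ltNge => /negP; apply.
have cE' : compact (setMl s^-1%g E) by exact: compact_setMl.
rewrite -[X in _ + X](haar_setMl hmu s^-1%g) -measureU; last 3 first.
- exact: compact_borel.
- exact: compact_borel.
- exact: disj.
apply: le_measure; rewrite ?inE.
- by apply: measurableU; exact: compact_borel.
- exact: open_borel.
- move=> x [/EU//|]; rewrite /setMl /= invgK => /sU /=.
  by rewrite mulKg.
Qed.

(* K s misses K for s in S, hence so do the translates s^-1 K^-1 and K^-1. *)
Lemma haar_null_boundary (B O S : set G) (C : set G) :
  closed B -> open O -> compact C -> closure S 1%g ->
  (forall b s, B b -> S s -> O (b * s)%g) ->
  mu (C `&` (B `\` O)) = 0.
Proof.
move=> cB oO cC S1 BSO; set K := C `&` (B `\` O).
have cK : compact K.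
  by apply: compact_closedI => //; apply: closedI => //; exact: open_closedC.
have VVK : setV (setV K) = K.
  by rewrite !setVE; apply/seteqP; split => x /=; rewrite invgK.
rewrite -VVK; apply: haar_null_setV; first exact: setV_compact.
apply: haar_null_translates S1 _; first exact: setV_compact.
move=> s Ss; rewrite -subset0 => x [Vx].
rewrite /setMl /= invgK setVE /= => -[_ [Bx _]].
move: Vx; rewrite setVE => -[_ [_]]; apply.
by rewrite -[x^-1%g](mulgVK s) -invgM; exact: BSO.
Qed.

End haar_null.

(** * The order compactification *)

Section order_compactification_units.
Context (G : topologicalGroupType).
Hypotheses (hG : hausdorff_space G) (lcG : locally_compact [set: G]).
Context (P : submonoid G) (Pclosed : closed P).
Hypothesis Pgen : forall g : G, exists a b : P, g = val a / val b.
Local Notation X := (order_compactification Pclosed).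
Local Notation actX := (order_action Pclosed hG lcG).

(** If [x] is in [A] but not in [B], a compact neighbourhood [K] of [x] away from [B] separates
    them: sets hitting the interior of [K] against sets missing [K]. *)
Lemma closedSet_hausdorff : hausdorff_space (closedSet G).
Proof.
have sub (A B : closedSet G) : cluster (nbhs A) B -> A `<=` B.
  move=> clAB x Ax; apply: contrapT => nBx.
  have : nbhs x (~` (B : set G)).
    by apply: open_nbhs_nbhs; split => //; exact/closed_openC/closedSetP.
  move=> /(lc_compact_nbhs hG lcG)[K [Kx cK _ KB]].
  have nA : nbhs A (hits K°).
    apply: open_nbhs_nbhs; split; first exact/open_hits/open_interior.
    by exists x.
  have nB : nbhs B (misses K).
    apply: open_nbhs_nbhs; split; first exact: open_misses.
    by rewrite /misses /= -subset0 => y [By /KB].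
  have [C [[y [Cy /interior_subset Ky]] CK]] := clAB _ _ nA nB.
  by have : ((C : set G) `&` K) y by []; rewrite CK.
move=> A B clAB; apply: closedSet_inj; apply/seteqP; split; apply: sub => //.
by move=> U V BU AV; rewrite setIC; exact: clAB.
Qed.

Lemma order_compactification_hausdorff : hausdorff_space X.
Proof. exact/set_type_hausdorff/closedSet_hausdorff. Qed.

Lemma order_closureP (A : X) U : nbhs (val A) U ->
  exists2 a, (P : set G) a & exists2 B, U B & B = setMr (setV P) a :> set G.
Proof.
move=> /(set_mem (valP A))[_ [[a Pa <-] Ua]]; exists a => //.
by eexists; first exact: Ua.
Qed.

(** Every [P^-1 a] contains [a^-1 a], and missing the compact set [[set 1]] is an open condition. *)
Lemma unit_mem1 (A : X) : (val A : set G) 1.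
Proof.
apply: contrapT => nA1.
have [|a Pa [B B1 BE]] := @order_closureP A (misses [set 1]).
  apply: open_nbhs_nbhs; split; first exact/open_misses/compact_set1.
  by rewrite /misses /= -subset0 => y [Ay y1]; move: Ay; rewrite y1.
suff : ((B : set G) `&` [set 1]) 1 by rewrite B1.
split=> //; rewrite BE; exists a^-1; last by rewrite mulVg.
by exists a.
Qed.

(** The sets [P^-1 a] are stable under left multiplication by [p^-1], and a failure for [A] would
    persist nearby: sets missing a compact neighbourhood [K] of [p^-1 x] while hitting [p] times its
    interior. *)
Lemma unit_mulV (A : X) p x : (P : set G) p -> (val A : set G) x ->
  (val A : set G) (p^-1 * x).
Proof.
move=> Pp Ax; apply: contrapT => nApx.
have : nbhs (p^-1 * x) (~` (val A : set G)).
  by apply: open_nbhs_nbhs; split => //; exact/closed_openC/closedSetP.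
move=> /(lc_compact_nbhs hG lcG)[K [Kx cK _ KA]].
have [|a Pa [B [BK [y [By Uy]]] BE]] :=
    @order_closureP A (misses K `&` hits (setMl p K°)).
  apply: open_nbhs_nbhs; split.
    apply: openI; first exact: open_misses.
    by apply: open_hits; apply: open_setMl; exact: open_interior.
  split; first by rewrite /misses /= -subset0 => y [Ay /KA].
  by exists x.
have : ((B : set G) `&` K) (p^-1 * y).
  split; last exact: interior_subset.
  move: By; rewrite BE => -[_ [q Pq <-] <-].
  exists (q * p)^-1; last by rewrite invgM !mulgA.
  by exists (q * p) => //; exact: submonoidM.
by rewrite BK.
Qed.

(* If w^-1 = p^-1 a then (P^-1 a) w = P^-1 p: hence the closure of the right
   translates of P^-1 contains A g as soon as g^-1 lies in A. *)
Lemma order_closure_setMr (A : X) g : (val A : set G) g^-1 ->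
  order_closure Pclosed (closedMr (val A) g).
Proof.
move=> Ag U Ug.
have [[V W] /= [VA Wg] VWU] := @closedMr_continuous G hG lcG (val A, g) U Ug.
move: Wg; rewrite nbhsE => -[W' [oW' W'g] W'W].
have [|a Pa [B [VB [w [Bw W'w]]] BE]] :=
    @order_closureP A (V `&` hits [set w | W' w^-1]).
  apply: filterI => //; apply: open_nbhs_nbhs; split.
    by apply/open_hits/open_comp => // x _; exact: invg_continuous.
  by exists g^-1; split=> //=; rewrite invgK.
move: (Bw); rewrite BE => -[_ [p Pp <-] pw].
exists (closedMr B w^-1); split; last first.
  by apply: (VWU (B, w^-1)); split=> //; exact: W'W.
exists p => //; apply: closedSet_inj => /=; rewrite BE.
rewrite -pw; apply/seteqP; split=> [_ [x Px <-]|_ [_ [x Px <-] <-]].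
  by exists (x * a); [exists x | rewrite invgM invgK !mulgA mulgK].
by exists x => //; rewrite invgM invgK !mulgA mulgK.
Qed.

(** If [A a = B b], then [b] lies in [A a] because 1 lies in [B], whence [b a^-1] is in [A].
    Conversely the source of the arrow is [A g], which [order_closure_setMr] places in [X]. *)
Lemma sdp_orderP (A : X) g : sdp_set actX (A, g) <-> (val A : set G) g^-1.
Proof.
split=> [[a [b [B /= [-> /(congr1 val) AB]]]]|Ag].
  have : (setMr (val B : set G) (val b)) (val b).
    by exists 1; [exact: unit_mem1 | rewrite mul1g].
  move/(congr1 (@closedSet_set _)) : AB => /= <- [x Ax <-].
  by rewrite invgF mulgK.
have [a [b gE]] := Pgen g.
exists a, b, (exist _ (closedMr (val A) g) (mem_set (order_closure_setMr Ag))).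
split=> //=; apply: val_inj => /=.
by rewrite closedMrM gE mulgVK.
Qed.

Lemma Qset_order (A : X) : Qset actX A = setV (val A : set G).
Proof. by rewrite setVE; apply/seteqP; split=> g /sdp_orderP. Qed.

Lemma order_conditionsA : conditionsA actX.
Proof.
split; last first.
  move=> A B; rewrite !Qset_order => /(congr1 (@setV G)); rewrite !setVK => AB.
  by apply: val_inj; exact: closedSet_inj.
(* [point] is [P^-1] itself: its [Q] is [P], and its orbit is the set whose closure defines [X]. *)
exists point; split; first by rewrite /conditionA1 Qset_order setVK.
move=> U [A UA] oU.
have : nbhs A U by exact: open_nbhs_nbhs.
move: oU => [V oV VU] _; rewrite -VU in UA *.
have [a Pa [B VB BE]] := order_closureP (open_nbhs_nbhs (conj oV UA)).
exists (actX point (exist _ a (mem_set Pa))); split; last first.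
  by exists (exist _ a (mem_set Pa)).
rewrite /= (_ : set_val _ = B)//.
exact: closedSet_inj.
Qed.

End order_compactification_units.

(** * Change of variables *)

Section integral_transfer.
Context d d' (T1 : measurableType d) (T2 : measurableType d') (R : realType).
Variable mu : {measure set T1 -> \bar R}%R.
Local Open Scope ereal_scope.

(* Unlike integral_pushforward, no integrability is required. *)
Lemma pushforward_integral (phi : T1 -> T2) (f : T2 -> \bar R) :
  measurable_fun setT phi -> measurable_fun setT f ->
  \int[pushforward mu phi]_y f y = \int[mu]_x f (phi x).
Proof.
move=> mphi mf; rewrite [LHS]integralE [RHS]integralE.
congr (_ - _); rewrite ge0_integral_pushforward//.
- by rewrite -funepos_comp.
- exact: measurable_funepos.
- by rewrite -funeneg_comp.
- exact: measurable_funeneg.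
Qed.

Lemma mrestr_integral (D : set T1) (mD : measurable D) (f : T1 -> \bar R) :
  measurable_fun setT f ->
  \int[mrestr mu mD]_x f x = \int[mu]_(x in D) f x.
Proof.
have key (g : T1 -> \bar R) : (forall x, 0 <= g x) -> measurable_fun setT g ->
    \int[mrestr mu mD]_x g x = \int[mu]_(x in D) g x.
  move=> g0 mg; rewrite (@ge0_negligible_integral _ _ _ _ setT (~` D))//.
  - rewrite setTD setCK; apply: eq_measure_integral => A mA AD.
    by rewrite /= /mrestr setIidl.
  - exact: measurableC.
  - by rewrite /= /mrestr setICl measure0.
move=> mf; rewrite [LHS]integralE [RHS]integralE.
by congr (_ - _); apply: key => //;
  [exact: measurable_funepos|exact: measurable_funeneg].
Qed.

End integral_transfer.

Section borel_functions.
Context (R : realType).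

Lemma continuous_borel (S T : ptopologicalType) (f : S -> T) :
  continuous f -> measurable_fun setT (f : borelType S -> borelType T).
Proof.
move=> cf; apply: (@measurability _ _ (borelType S) (borelType T) _ _ open) => //.
move=> _ [U oU <-]; rewrite setTI; apply: open_borel.
by apply: open_comp => // x _; exact: cf.
Qed.

Lemma continuous_borelR (T : ptopologicalType) (f : T -> R) :
  continuous f -> measurable_fun setT (f : borelType T -> R).
Proof.
move=> cf; apply: (measurability _ (RGenOInfty.measurableE R)).
move=> _ [_ [a ->] <-]; rewrite setTI; apply: open_borel.
by apply: open_comp => [x _|]; [exact: cf|exact: interval_open].
Qed.

End borel_functions.

Section haar_integral.
Context (R : realType) (G : topologicalGroupType).
Variable mu : {measure set (borelType G) -> \bar R}%R.
Hypothesis hmu : is_haar_measure mu.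
Local Open Scope ereal_scope.

Lemma haar_integral_mulgl (g : G) (F : borelType G -> \bar R) :
  measurable_fun setT F -> \int[mu]_x F (g * x)%g = \int[mu]_x F x.
Proof.
move=> mF.
have mg : measurable_fun setT
    ((fun x => g * x)%g : borelType G -> borelType G).
  by apply: continuous_borel; exact: mulgl_continuous.
rewrite -(pushforward_integral _ mg mF); apply: eq_measure_integral => A mA _.
rewrite /pushforward -[RHS](haar_setMl hmu g^-1%g).
by congr (mu _); apply/funext => x; rewrite /setMl /= invgK.
Qed.

End haar_integral.

(** * The semi-direct product groupoid *)

Section semidirect_topology.
Context (G : topologicalGroupType) (P : submonoid G).
Context (Y : ptopologicalType) (A : injective_action P Y).

Lemma sdp_hausdorff : hausdorff_space Y -> hausdorff_space G ->
  hausdorff_space (sdp A).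
Proof. by move=> hY hG; apply: set_type_hausdorff; exact: prod_hausdorff. Qed.

Definition sdp_cocycle (g : sdp A) : G := (val g).2.

Lemma sdp_val_continuous : continuous (fun g : sdp A => val g : Y * G).
Proof. exact: initial_continuous. Qed.

Lemma sdp_rng_continuous : continuous (@sdp_rng G P Y A).
Proof.
move=> g; apply: (@continuous_comp _ _ _ (fun g : sdp A => val g) fst).
  exact: sdp_val_continuous.
exact: cvg_fst.
Qed.

Lemma sdp_cocycle_continuous : continuous sdp_cocycle.
Proof.
move=> g; apply: (@continuous_comp _ _ _ (fun g : sdp A => val g) snd).
  exact: sdp_val_continuous.
exact: cvg_snd.
Qed.

Lemma sdp_nbhs (g : sdp A) U : nbhs g U ->
  exists V W, [/\ nbhs (sdp_rng g) V, nbhs (sdp_cocycle g) W &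
    forall h : sdp A, V (sdp_rng h) -> W (sdp_cocycle h) -> U h].
Proof.
rewrite nbhsE => -[_ [[V oV <-] Vg] VU].
have [[V1 V2] /= [V1g V2g] V12] : nbhs (val g : Y * G) V by exact: open_nbhs_nbhs.
exists V1, V2; split => // h V1h V2h; apply: VU; apply: V12; split=> //.
Qed.

(* Arrows with given range and cocycle value; the value at pairs outside the
   groupoid is irrelevant. *)
Definition sdp_arrow (x : Y) (g : G) : sdp A :=
  match pselect (sdp_set A (x, g)) with
  | left xg => sdp_mk xg
  | right _ => sdp_id A x
  end.

Lemma sdp_rng_arrow x g : sdp_rng (sdp_arrow x g) = x.
Proof. by rewrite /sdp_arrow; case: pselect. Qed.

Lemma sdp_arrowE x g : Qset A x g -> val (sdp_arrow x g) = (x, g).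
Proof. by rewrite /sdp_arrow; case: pselect. Qed.

Lemma sdp_cocycle_arrow x g : Qset A x g -> sdp_cocycle (sdp_arrow x g) = g.
Proof. by rewrite /sdp_cocycle => /sdp_arrowE ->. Qed.

Lemma Qset_cocycle (g : sdp A) : Qset A (sdp_rng g) (sdp_cocycle g).
Proof.
rewrite /Qset /sdp_rng /sdp_cocycle /= -surjective_pairing.
exact: set_mem (valP g).
Qed.

Lemma sdp_arrowK (g : sdp A) : sdp_arrow (sdp_rng g) (sdp_cocycle g) = g.
Proof.
apply: val_inj; rewrite sdp_arrowE; last exact: Qset_cocycle.
by rewrite /sdp_rng /sdp_cocycle -surjective_pairing.
Qed.

(** Composition with [k] and with its inverse identifies the two fibres. Both the invariance of the
    Haar system and the equivariance of [Q] come from this. *)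
Lemma Qset_src (Pgen : forall g : G, exists a b : P, g = val a / val b)
    (k : sdp A) x :
  Qset A (sdp_rng k) (sdp_cocycle k * x) <-> Qset A (sdp_src Pgen k) x.
Proof.
split=> [Qkx|Qx].
- have kV : sdp_src Pgen (sdp_inv Pgen k) =
      sdp_rng (sdp_arrow (sdp_rng k) (sdp_cocycle k * x)).
    by rewrite sdp_rng_arrow sdp_src_inv.
  have := Qset_cocycle (sdp_comp Pgen (sdp_inv Pgen k)
    (sdp_arrow (sdp_rng k) (sdp_cocycle k * x))).
  by rewrite sdp_rng_comp// /sdp_cocycle sdp_compE//= sdp_arrowE//= mulKg.
- have kx : sdp_src Pgen k = sdp_rng (sdp_arrow (sdp_src Pgen k) x).
    by rewrite sdp_rng_arrow.
  have := Qset_cocycle (sdp_comp Pgen k (sdp_arrow (sdp_src Pgen k) x)).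
  by rewrite sdp_rng_comp// /sdp_cocycle sdp_compE//= sdp_arrowE.
Qed.

(** The map is continuous on the closed set [Q_x] and constant, equal to the unit at [x], off it. *)
Lemma measurable_sdp_arrow x : closed (Qset A x) ->
  measurable_fun setT (sdp_arrow x : borelType G -> borelType (sdp A)).
Proof.
move=> clQ; have mQ : measurable (Qset A x : set (borelType G)) := closed_borel clQ.
apply: (@measurability _ _ (borelType G) (borelType (sdp A)) _ _ open) => //.
move=> _ [_ [V oV <-] <-]; rewrite setTI.
pose B := [set g : G | V (x, g)].
have oB : open B.
  apply: open_comp => // g _; apply: cvg_pair => /=; first exact: cvg_cst.
  exact: cvg_id.
rewrite (_ : _ @^-1` _ = (Qset A x `&` B) `|`
    (if `[< V (x, 1) >] then ~` Qset A x else set0)); last first.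
  apply/seteqP; split=> g; rewrite /preimage /=.
    rewrite /sdp_arrow; case: pselect => [Qg|nQg] /=; first by left.
    by right; rewrite asboolT.
  rewrite /sdp_arrow; case: pselect => [Qg|nQg] /= [[]//|].
  - by case: asboolP.
  - by case: asboolP.
apply: measurableU; first by apply: measurableI => //; exact: open_borel.
by case: asboolP => _; [exact: measurableC | exact: measurable0].
Qed.

End semidirect_topology.

(** * The measure on a fibre of the groupoid *)

Section unit_measure.
Context (R : realType) (G : topologicalGroupType).
Hypotheses (hG : hausdorff_space G) (lcG : locally_compact [set: G]).
Context (P : submonoid G) (Pclosed : closed P).
Hypothesis Pgen : forall g : G, exists a b : P, g = val a / val b.
Hypothesis Pint : (P : set G) `<=` closure (interior P).
Variable mu : {measure set (borelType G) -> \bar R}%R.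
Hypothesis hmu : is_haar_measure mu.
Local Notation X := (order_compactification Pclosed).
Local Notation actX := (order_action Pclosed hG lcG).
Local Open Scope ereal_scope.

Lemma closed_Qset_order (A : X) : closed (Qset actX A).
Proof. by rewrite Qset_order//; apply/closed_setV/closedSetP. Qed.

Lemma Qset_orderM (A : X) g p : Qset actX A g -> (P : set G) p ->
  Qset actX A (g * p)%g.
Proof.
rewrite Qset_order// setVE => Ag Pp; rewrite /= invgM.
exact: unit_mulV.
Qed.

Lemma closure_interior1 : closure (interior P) 1%g.
Proof. exact/Pint/submonoid1. Qed.

(** Restriction comes before the push-forward, as [sdp_arrow] sends all of [G] outside [Q_A] to the
    unit at [A]. *)
Definition unit_measure (A : X) : set (borelType (sdp actX)) -> \bar R :=
  pushforward (mrestr mu (closed_borel (@closed_Qset_order A)))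
    (sdp_arrow actX A : borelType G -> borelType (sdp actX)).

Section instance.
Variable A : X.

Let mA := measurable_sdp_arrow (@closed_Qset_order A).

Let unit_measure0 : unit_measure A set0 = 0.
Proof. exact: measure0. Qed.

Let unit_measure_ge0 E : 0 <= unit_measure A E.
Proof. exact: measure_ge0. Qed.

Let unit_measure_sigma_additive : semi_sigma_additive (unit_measure A).
Proof.
exact: (@measure_semi_sigma_additive _ _ _
  (pushforward (mrestr mu (closed_borel (@closed_Qset_order A)))
    (sdp_arrow actX A : borelType G -> borelType (sdp actX)))).
Qed.

HB.instance Definition _ := isMeasure.Build _ _ _ (unit_measure A)
  unit_measure0 unit_measure_ge0 unit_measure_sigma_additive.

End instance.

Lemma unit_measureE A E :
  unit_measure A E = mu (sdp_arrow actX A @^-1` E `&` Qset actX A).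
Proof. by []. Qed.

Lemma unit_measure_integral A (F : borelType (sdp actX) -> \bar R) :
  measurable_fun setT F ->
  \int[unit_measure A]_g F g = \int[mu]_(g in Qset actX A) F (sdp_arrow actX A g).
Proof.
have mA := measurable_sdp_arrow (@closed_Qset_order A).
move=> mF; rewrite /unit_measure pushforward_integral// mrestr_integral//.
exact: (measurableT_comp mF mA).
Qed.

Lemma unit_measure_compact A (K : set (sdp actX)) : compact K ->
  unit_measure A K < +oo.
Proof.
move=> cK; rewrite unit_measureE.
have cK' : compact (@sdp_cocycle _ _ _ actX @` K).
  apply: continuous_compact => //; apply: continuous_subspaceT.
  exact: sdp_cocycle_continuous.
apply: le_lt_trans (haar_compact hmu cK'); apply: le_measure; rewrite ?inE.
- apply: measurableI; last by apply: closed_borel; exact: closed_Qset_order.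
  rewrite -[X in measurable X]setTI; apply: measurable_sdp_arrow => //.
    exact: closed_Qset_order.
  apply: compact_borel => //; apply: sdp_hausdorff => //.
  exact: order_compactification_hausdorff.
- exact: compact_borel.
- by move=> g [Kg Qg]; exists (sdp_arrow actX A g) => //; rewrite sdp_cocycle_arrow.
Qed.

Lemma unit_measure_support A :
  measure_support (unit_measure A) = [set g | sdp_rng g = A].
Proof.
apply/seteqP; split=> [g supp|g <-{A} U oU Ug].
  apply: contrapT => gA.
  have oU : open [set h : sdp actX | sdp_rng h <> A].
    apply: (@open_comp _ _ (@sdp_rng _ _ _ actX) (~` [set A])).
      by move=> h _; exact: sdp_rng_continuous.
    apply: closed_openC; apply: accessible_closed_set1; apply: hausdorff_accessible.
    exact: order_compactification_hausdorff.
  have := supp _ oU gA; rewrite /= unit_measureE (_ : _ `&` _ = set0) ?measure0 ?ltxx//.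
  by rewrite -subset0 => h [] /=; rewrite sdp_rng_arrow.
have [V [W [Vg Wg VWU]]] := sdp_nbhs (open_nbhs_nbhs (conj oU Ug)).
set A := sdp_rng g in Vg *; set k := sdp_cocycle g in Wg *.
have Qk : Qset actX A k by exact: Qset_cocycle.
(* 1 is a limit of [Int(P)], so the open set [k Int(P)], contained in [Q_A], comes arbitrarily close
   to [k]. *)
have [p [Pp Wkp]] : exists p, P° p /\ W° (k * p)%g.
  apply: (closure_interior1 (B := [set p | W° (k * p)%g])).
  by apply: nbhs_mulgl; rewrite mulg1; exact: nbhs_interior.
have oO : open (setMl k P° `&` W°).
  by apply: openI; [apply: open_setMl|]; exact: open_interior.
rewrite /= unit_measureE; apply: (@lt_le_trans _ _ (mu (setMl k P° `&` W°))).
  apply: (haar_open hmu) => //.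
  by exists (k * p)%g; split=> //; rewrite /setMl /= mulKg.
apply: le_measure; rewrite ?inE; first exact: open_borel.
  apply: measurableI; last by apply: closed_borel; exact: closed_Qset_order.
  rewrite -[X in measurable X]setTI; apply: measurable_sdp_arrow => //.
    exact: closed_Qset_order.
  exact: open_borel.
move=> x [/interior_subset Px /interior_subset Wx].
have Qx : Qset actX A x by rewrite -(mulVKg k x); exact: Qset_orderM.
split=> //; apply: VWU; first by rewrite sdp_rng_arrow; exact: nbhs_singleton.
by rewrite sdp_cocycle_arrow.
Qed.

End unit_measure.

(** * Haar system on the order compactification *)

Section haar_system_order.
Context (R : realType) (G : topologicalGroupType).
Hypotheses (hG : hausdorff_space G) (scG : @second_countable G).
Hypothesis lcG : locally_compact [set: G].
Context (P : submonoid G) (Pclosed : closed P).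
Hypothesis Pgen : forall g : G, exists a b : P, g = val a / val b.
Hypothesis Pint : (P : set G) `<=` closure (interior P).
Variable mu : {measure set (borelType G) -> \bar R}%R.
Hypothesis hmu : is_haar_measure mu.
Local Notation X := (order_compactification Pclosed).
Local Notation actX := (order_action Pclosed hG lcG).
Local Open Scope ring_scope.

(** For [B] near [A] some [k'] in [Q_B] is close to [k]; then [k'^-1 h] is still in [Int(P)], and
    [h = k' (k'^-1 h)] lies in [Q_B P], hence in [Q_B]. *)
Lemma Qset_near_in (A : X) (k g : G) : Qset actX A k -> P° (k^-1 * g)%g ->
  \forall h \near g & B \near A, Qset actX B h.
Proof.
move=> Qk Pkg.
have [[U V] /= [Uk Vg] UVP] : \forall h \near k & y \near g, P° (h^-1 * y)%g.
  apply: (@mulVg_continuous G (k, g)); apply: open_nbhs_nbhs.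
  by split; first exact: open_interior.
move: Uk; rewrite nbhsE => -[U' [oU' U'k] U'U].
have oH : open [set x : G | U' x^-1%g].
  by apply: open_comp => // x _; exact: invg_continuous.
have nA : nbhs (val A) (hits [set x : G | U' x^-1%g]).
  apply: open_nbhs_nbhs; split; first exact: open_hits.
  by exists k^-1%g; split; [move: Qk; rewrite Qset_order// setVE | rewrite /= invgK].
exists (V, val @^-1` hits [set x : G | U' x^-1%g]).
  by split=> //=; exact: initial_continuous.
move=> [h B] /= [Vh [y [By U'y]]].
rewrite -(mulVKg y^-1%g h); apply: Qset_orderM => //.
  by rewrite Qset_order// setVE /= invgK.
by apply: interior_subset; apply: (UVP (y^-1%g, h)); split=> //; exact: U'U.
Qed.

Lemma Qset_near_out (A : X) (g : G) : ~ Qset actX A g ->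
  \forall h \near g & B \near A, ~ Qset actX B h.
Proof.
rewrite Qset_order// setVE => nAg.
have : nbhs g^-1%g (~` (val A : set G)).
  by apply: open_nbhs_nbhs; split => //; exact/closed_openC/closedSetP.
move=> /(lc_compact_nbhs hG lcG)[K [Kg cK _ KA]].
exists ([set h | K h^-1%g], val @^-1` misses K) => /=.
  split; first exact: invg_continuous.
  apply: initial_continuous; apply: open_nbhs_nbhs.
  split; first exact: open_misses.
  by rewrite /misses /= -subset0 => x [Ax /KA].
move=> [h B] /= [Kh BK]; rewrite Qset_order// setVE => Bh.
by have : ((val B : set G) `&` K) h^-1%g by []; rewrite BK.
Qed.

Section test_function.
Variable f : sdp actX -> R.
Hypotheses (cf : continuous f) (kf : compactly_supported f).

(** Extension by zero brings the integrals over all fibres to the single measure space [(G, mu)],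
    where different units can be compared. *)
Definition extend0 (A : X) : borelType G -> R :=
  (fun g => f (sdp_arrow actX A g)) \_ (Qset actX A).

Lemma extend0_in A g : Qset actX A g -> extend0 A g = f (sdp_arrow actX A g).
Proof. by move=> Qg; rewrite /extend0 patchE mem_set. Qed.

Lemma extend0_out A g : ~ Qset actX A g -> extend0 A g = 0.
Proof. by move=> Qg; rewrite /extend0 patchE memNset. Qed.

Lemma measurable_extend0 A : measurable_fun setT (extend0 A).
Proof.
have clQ : closed (Qset actX A) by exact: closed_Qset_order.
have mf := continuous_borelR cf.
have ma := measurable_sdp_arrow clQ.
apply/measurable_restrict => //; first exact: closed_borel.
by apply: measurable_funTS; exact: (measurableT_comp mf ma).
Qed.

Lemma extend0_integral A :
  \int[unit_measure Pgen mu A]_g f g = \int[mu]_g extend0 A g.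
Proof.
congr fine; rewrite unit_measure_integral; last first.
  by apply/measurable_EFinP; exact: continuous_borelR.
rewrite [LHS]integral_mkcond; apply: eq_integral => g _.
by rewrite /extend0 /patch; case: ifP.
Qed.

Let K : set G := @sdp_cocycle _ _ _ actX @` closure [set g | f g != 0].

Let compact_K : compact K.
Proof.
apply: continuous_compact => //; apply: continuous_subspaceT.
exact: sdp_cocycle_continuous.
Qed.

Let extend0_supp A g : ~ K g -> extend0 A g = 0.
Proof.
move=> nKg; have [Qg|/extend0_out//] := pselect (Qset actX A g).
rewrite extend0_in//; apply: contrapT => /eqP fg; apply: nKg.
exists (sdp_arrow actX A g); last by rewrite sdp_cocycle_arrow.
exact: subset_closure.
Qed.

Let extend0_bounded : exists2 M, 0 <= M & forall A g, `|extend0 A g| <= M.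
Proof.
have cfK : compact (f @` closure [set g | f g != 0]).
  by apply: continuous_compact => //; exact: continuous_subspaceT.
have [M [_ MP]] := compact_bounded cfK.
exists (`|M| + 1) => [|A g]; first by rewrite addr_ge0.
have [Qg|/extend0_out ->] := pselect (Qset actX A g); last first.
  by rewrite normr0 addr_ge0.
rewrite extend0_in//; have [->|fg] := eqVneq (f (sdp_arrow actX A g)) 0.
  by rewrite normr0 addr_ge0.
apply: (MP (`|M| + 1)); first by rewrite ltr_pwDr// ler_norm.
by exists (sdp_arrow actX A g) => //; exact: subset_closure.
Qed.

Let integrable_indicT (W : set (borelType G)) : measurable W ->
  (mu W < +oo)%E -> mu.-integrable setT (EFin \o \1_W).
Proof.
move=> mW Wfin; apply/integrableP; split.
  by apply/measurable_EFinP; exact: measurable_indic.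
rewrite (eq_integral (EFin \o \1_W)); last first.
  by move=> g _; rewrite /= ger0_norm.
by rewrite integral_indic// setIT.
Qed.

Let integrable_indicZ (M : R) (W : set (borelType G)) : measurable W ->
  (mu W < +oo)%E -> mu.-integrable setT (EFin \o (fun g => M * \1_W g)).
Proof.
move=> mW Wfin; apply: (@integrableZl _ _ _ mu setT measurableT M (EFin \o \1_W)).
exact: integrable_indicT.
Qed.

Let integrable_extend0 A : mu.-integrable setT (EFin \o extend0 A).
Proof.
have [M M0 MP] := extend0_bounded.
have mK : measurable (K : set (borelType G)) by exact: compact_borel.
apply: (@le_integrable _ _ _ mu setT measurableT _ (EFin \o (fun g => M * \1_K g))).
- by apply/measurable_EFinP; exact: measurable_extend0.
- move=> g _ /=; rewrite lee_fin indicE; have [Kg|nKg] := pselect (K g).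
    by rewrite mem_set// mulr1 (ger0_norm M0).
  by rewrite extend0_supp// normr0.
- by apply: integrable_indicZ => //; exact: haar_compact.
Qed.

(* The only points where extend0 B h fails to converge to extend0 A g as
   (B, h) -> (A, g) are those of Q_A outside Q_A Int(P), a null set. *)
Let extend0_near (A : X) (g : G) (e : R) : 0 < e ->
  (Qset actX A g -> exists2 k, Qset actX A k & P° (k^-1 * g)%g) ->
  \forall h \near g & B \near A, `|extend0 B h - extend0 A h| < e.
Proof.
move=> e0 QPg; have [Qg|nQg] := pselect (Qset actX A g); last first.
  have [[U V] /= [Ug VA] UV] := Qset_near_out nQg.
  exists (U, V) => // -[h B] /= [Uh VB].
  rewrite !extend0_out ?subrr ?normr0//.
    by apply: (UV (h, A)); split=> //; exact: nbhs_singleton.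
  exact: (UV (h, B)).
have [k Qk Pkg] := QPg Qg.
have [[U V] /= [Ug VA] UV] := Qset_near_in Qk Pkg.
have e2 : 0 < e / 2 by rewrite divr_gt0.
have : \forall h \near sdp_arrow actX A g, `|f (sdp_arrow actX A g) - f h| < e / 2.
  by move/cvgrPdist_lt : (@cf (sdp_arrow actX A g)); exact.
move=> /sdp_nbhs[V' [U' []]].
rewrite sdp_rng_arrow sdp_cocycle_arrow// => V'A U'g near_f.
exists (U `&` U', V `&` V') => /=; first by split; exact: filterI.
move=> [h B] /= [[Uh U'h] [VB V'B]].
have QBh : Qset actX B h by exact: (UV (h, B)).
have VA1 : V A by exact: nbhs_singleton.
have QAh : Qset actX A h by exact: (UV (h, A)).
rewrite !extend0_in// (splitr e).
rewrite -[X in `|X|](subrKA (f (sdp_arrow actX A g))).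
apply: (le_lt_trans (ler_normD _ _)); apply: ltrD.
- by rewrite distrC; apply: near_f; rewrite ?sdp_rng_arrow ?sdp_cocycle_arrow.
- by apply: near_f; rewrite ?sdp_rng_arrow ?sdp_cocycle_arrow//; exact: nbhs_singleton.
Qed.

(** The exceptional null set is enclosed in an open [W] of small measure. For [B] near [A] the
    integrands differ by less than [e1] on the compact set [K \ W], by at most [2 M] on [W], and
    both vanish off [K]. *)
Lemma unit_measure_continuous :
  continuous (fun A : X => \int[unit_measure Pgen mu A]_g f g).
Proof.
rewrite (_ : (fun _ => _) = (fun A => \int[mu]_g extend0 A g)); last first.
  by apply/funext => A; exact: extend0_integral.
move=> A; apply/(@cvgrPdist_lt R R X (nbhs A) (nbhs_filter A)) => e e0.
have [M M0 MP] := extend0_bounded.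
have mK : measurable (K : set (borelType G)) by exact: compact_borel.
have Kfin : (mu K < +oo)%E by exact: haar_compact.
pose c := fine (mu K).
have c0 : 0 <= c by rewrite fine_ge0// measure_ge0.
(* Chosen so that [e1 * (c + 1)] and [(2 * M + 1) * e2] are both [e / 2]; the added 1 avoids zero
   denominators and makes the final inequality strict. *)
pose e1 := e / (2 * (c + 1)); pose e2 := e / (2 * (2 * M + 1)).
have e10 : 0 < e1 by rewrite divr_gt0// mulr_gt0// ltr_wpDl.
have M21 : 0 < 2 * M + 1 by rewrite ltr_wpDl// mulr_ge0.
have e20 : 0 < e2 by rewrite divr_gt0// mulr_gt0.
pose O := [set g : G | exists2 k, Qset actX A k & P° (k^-1 * g)%g].
have oO : open O.
  rewrite (_ : O = \bigcup_(k in Qset actX A) setMl k P°); last first.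
    by apply/seteqP; split=> g [k Qk Pk]; exists k.
  by apply: bigcup_open => k _; apply: open_setMl; exact: open_interior.
have clQ : closed (Qset actX A) by exact: closed_Qset_order.
have N0 : mu (K `&` (Qset actX A `\` O)) = 0.
  apply: (haar_null_boundary hG lcG scG hmu clQ oO compact_K (closure_interior1 Pint)).
  by move=> k p Qk Pp; exists k => //; rewrite mulKg.
have [|W [oW NW We]] :=
    @haar_outer_regular _ _ _ hmu (K `&` (Qset actX A `\` O)) e2%:E.
  by rewrite N0 lte_fin.
have mW : measurable (W : set (borelType G)) by exact: open_borel.
have Wfin : (mu W < +oo)%E by apply: lt_trans We (ltry _).
have cKW : compact (K `\` W) by apply: compact_closedI => //; exact: open_closedC.
have /compact_near_coveringP cov := cKW.
have near_A : \forall B \near A,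
    K `\` W `<=` (fun h => `|extend0 B h - extend0 A h| < e1).
  apply: (cov X (nbhs A) (fun B h => `|extend0 B h - extend0 A h| < e1)) => g [Kg nWg].
  apply: extend0_near => // Qg; apply: contrapT => nO.
  by apply: nWg; apply: NW; split.
apply: (@filterS _ _ (@nbhs_filter X A) _ _ _ near_A) => B BA.
have iB := integrable_extend0 B; have iA := integrable_extend0 A.
have i1 := integrable_indicZ e1 mK Kfin.
have i2 := integrable_indicZ (2 * M) mW Wfin.
have iAB : mu.-integrable setT (EFin \o (fun g => extend0 A g - extend0 B g)).
  exact: (integrableB measurableT iA iB).
rewrite -RintegralB//; apply: le_lt_trans (le_normr_Rintegral _ iAB) _ => //.
apply: (@le_lt_trans _ _ (\int[mu]_g (e1 * \1_K g + 2 * M * \1_W g))).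
  apply: le_Rintegral => //.
  - exact: (integrable_norm iAB).
  - exact: (integrableD measurableT i1 i2).
  - move=> g _; rewrite distrC; rewrite !indicE.
    have [Wg|nWg] := pselect (W g).
      rewrite (mem_set Wg) mulr1 (le_trans (ler_normB _ _))//.
      by rewrite mulr_natl mulr2n ler_wpDl ?lerD// mulr_ge0// ltW.
    rewrite [g \in W]memNset// mulr0 addr0.
    have [Kg|nKg] := pselect (K g).
      by rewrite mem_set// mulr1 ltW//; exact: BA.
    by rewrite !extend0_supp// subrr normr0 mulr_ge0// ltW.
have RindicE (V : set (borelType G)) : measurable V ->
    \int[mu]_g \1_V g = fine (mu V).
  by move=> mV; rewrite /Rintegral integral_indic// setIT.
rewrite RintegralD// !RintegralZl//; [|exact: integrable_indicT..].
rewrite !RindicE// -/c.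
have We' : fine (mu W) <= e2.
  by rewrite -lee_fin fineK ?ge0_fin_numE ?measure_ge0// ltW.
apply: (@le_lt_trans _ _ (e1 * c + 2 * M * e2)).
  by rewrite lerD2l ler_wpM2l// mulr_ge0.
have -> : e = e1 * (c + 1) + (2 * M + 1) * e2.
  rewrite /e1 /e2; field.
  by rewrite !gt_eqF// ltr_wpDl.
apply: ltrD.
  by rewrite ltr_pM2l// ltrDl.
by rewrite ltr_pM2r// ltrDl.
Qed.

(** Both sides become integrals over [G], of [extend0 A] at [g x] and at [x], so that left
    invariance of [mu] applies. The first integral may be restricted to [Q_B], since [g x] in [Q_A]
    forces [x] into [Q_B]. *)
Lemma unit_measure_invariant (k : sdp actX) :
  \int[unit_measure Pgen mu (sdp_src Pgen k)]_(h in
      [set h | sdp_rng h = sdp_src Pgen k]) f (sdp_comp Pgen k h) =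
  \int[unit_measure Pgen mu (sdp_rng k)]_h f h.
Proof.
set B := sdp_src Pgen k; set A := sdp_rng k; set g := sdp_cocycle k.
pose phi x := extend0 A (g * x)%g.
have mphi : measurable_fun setT (phi : borelType G -> R).
  have mg : measurable_fun setT
      ((fun x => g * x)%g : borelType G -> borelType G).
    by apply: continuous_borel; exact: mulgl_continuous.
  exact: (measurableT_comp (measurable_extend0 A) mg).
have compE h : sdp_rng h = B -> f (sdp_comp Pgen k h) = phi (sdp_cocycle h).
  move=> /esym kh; have Ek := sdp_compE kh.
  have kE : sdp_comp Pgen k h = sdp_arrow actX A (g * sdp_cocycle h)%g.
    by rewrite -[LHS]sdp_arrowK /sdp_rng /sdp_cocycle Ek.
  rewrite /phi extend0_in ?kE//.
  have := Qset_cocycle (sdp_comp Pgen k h).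
  by rewrite {1}/sdp_rng /sdp_cocycle Ek.
have Qphi x : Qset actX A (g * x)%g -> Qset actX B x by move/Qset_src; exact.
rewrite [RHS]extend0_integral; congr fine.
have clD : closed [set h : sdp actX | sdp_rng h = B].
  apply: (@preimage_closed _ _ (@sdp_rng _ _ _ actX) [set B]).
    by move=> h _; exact: sdp_rng_continuous.
  apply: accessible_closed_set1; apply: hausdorff_accessible.
  exact: order_compactification_hausdorff.
have mD : measurable ([set h | sdp_rng h = B] : set (borelType (sdp actX))).
  exact: closed_borel.
have mcoc : measurable_fun setT
    (@sdp_cocycle _ _ _ actX : borelType (sdp actX) -> borelType G).
  by apply: continuous_borel; exact: sdp_cocycle_continuous.
pose F : borelType (sdp actX) -> \bar R :=
  (EFin \o (phi \o @sdp_cocycle _ _ _ actX)) \_ [set h | sdp_rng h = B].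
have mF : measurable_fun setT F.
  apply/measurable_restrict => //; apply: measurable_funTS.
  by apply/measurable_EFinP; exact: (measurableT_comp mphi mcoc).
transitivity (\int[unit_measure Pgen mu B]_h F h)%E.
  rewrite [LHS]integral_mkcond; apply: eq_integral => h _.
  by rewrite /F /patch; case: ifPn => // /set_mem /= hB; rewrite compE.
rewrite unit_measure_integral// -(haar_integral_mulgl hmu g); last first.
  by apply/measurable_EFinP; exact: measurable_extend0.
rewrite [LHS]integral_mkcond; apply: eq_integral => x _.
rewrite /patch; case: ifPn => [/set_mem Qx|/negP Qx].
  by rewrite /F patchE mem_set /= ?sdp_rng_arrow// sdp_cocycle_arrow.
by rewrite extend0_out// => /Qphi Bx; apply: Qx; exact: mem_set.
Qed.

End test_function.

Lemma order_has_haar_system : has_haar_system R (semidirect Pgen actX).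
Proof.
exists (fun A => unit_measure Pgen mu A); split.
- by move=> A K cK; exact: unit_measure_compact.
- by move=> A; exact: unit_measure_support.
- by move=> f cf kf; exact: unit_measure_continuous.
- by move=> k f cf kf; exact: unit_measure_invariant.
Qed.

End haar_system_order.

(** * Openness of the range map *)

Section compact_action.
Context (R : realType) (G : topologicalGroupType).
Hypotheses (hG : hausdorff_space G) (lcG : locally_compact [set: G]).
Context (P : submonoid G).
Hypothesis Pgen : forall g : G, exists a b : P, g = val a / val b.
Hypothesis Pint : (P : set G) `<=` closure (interior P).
Context (Y : ptopologicalType) (actY : injective_action P Y).
Hypotheses (hY : hausdorff_space Y) (cY : compact [set: Y]).

Lemma interior_submonoidMl (a x : G) : (P : set G) a -> P° x -> P° (a * x).
Proof.
move=> Pa Px; have oP : open (setMl a P°) by exact/open_setMl/open_interior.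
have sub : setMl a P° `<=` P.
  move=> y /interior_subset Py; rewrite -(mulVKg a y).
  exact: submonoidM.
apply: (filterS sub); apply: open_nbhs_nbhs; split=> //.
by rewrite /setMl /= mulKg.
Qed.

(** Makes the action applicable to group elements; it is evaluated near interior points of [P],
    where it is continuous. *)
Let toP (x : G) : P :=
  match pselect ((P : set G) x) with
  | left Px => exist _ x (mem_set Px)
  | right _ => sub1 P
  end.

Let val_toP x : (P : set G) x -> val (toP x) = x.
Proof. by rewrite /toP; case: pselect. Qed.

Let toP_continuous x : P° x -> {for x, continuous toP}.
Proof.
move=> Px U; rewrite nbhsE => -[_ [[V oV <-] /= Vx] VU].
have Px' := interior_subset Px.
have nVx : nbhs x V.
  apply: open_nbhs_nbhs; split=> //.
  by rewrite -(val_toP Px'); exact: Vx.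
apply: filterS (filterI nVx Px) => y [Vy Py]; apply: VU.
by have : V (val (toP y)) by rewrite val_toP.
Qed.

Lemma act_continuousl (b : P) : continuous (fun y : Y => actY y b).
Proof.
move=> y; apply: (@continuous_comp _ _ _ (fun y => (y, b)) (fun z => actY z.1 z.2)).
  by apply: continuous_for_pair; [exact: cvg_id|exact: cst_continuous].
exact: (@act_continuous _ _ _ actY (y, b)).
Qed.

(* Writing g = a b^-1 and multiplying b by an interior point of P, the same
   denominator b serves all arrows near (y, g): these are then described by
   the closed condition y (g b) \in Y b. *)
Lemma closed_sdp_set : closed (sdp_set actY).
Proof.
move=> [y g] clyg.
have [a [b gab]] := Pgen g.
have [c Pc] : exists c, P° c.
  by have [c [Pc _]] := Pint (submonoid1 P) filterT; exists c.
pose c' : P := exist _ c (mem_set (interior_subset Pc)).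
pose d := subM b c'.
have Pgd : P° (g * val d).
  rewrite gab /= mulgA mulgVK; apply: interior_submonoidMl => //.
  exact: set_mem (valP a).
pose al (z : Y * G) := actY z.1 (toP (z.2 * val d)).
have cal : {for (y, g), continuous al}.
  apply: (@continuous_comp _ _ _ (fun z : Y * G => (z.1, toP (z.2 * val d)))
    (fun z => actY z.1 z.2)); last exact: (@act_continuous _ _ _ actY (_, _)).
  apply: continuous_for_pair => /=; first exact: cvg_fst.
  apply: (@continuous_comp _ _ _ (fun z : Y * G => z.2 * val d) toP).
    apply: (@continuous_comp _ _ _ snd (fun x => x * val d)); first exact: cvg_snd.
    exact: mulgr_continuous.
  exact: toP_continuous.
have clYd : closed [set actY z d | z in [set: Y]].
  apply: compact_closed => //; apply: continuous_compact => //.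
  by apply: continuous_subspaceT; exact: act_continuousl.
have [[z _ zE]|nal] := pselect ([set actY z d | z in [set: Y]] (al (y, g))).
  exists (toP (g * val d)), d, z; split; last by rewrite zE.
  by rewrite /= val_toP ?mulgK//; exact: interior_subset.
have n1 : nbhs (y, g) (al @^-1` (~` [set actY z d | z in [set: Y]])).
  by apply: cal; apply: open_nbhs_nbhs; split=> //; exact: closed_openC.
have n2 : nbhs (y, g) [set z : Y * G | P° (z.2 * val d)].
  apply: (@cvg_snd _ _ (nbhs y) (nbhs g) _ [set x : G | P° (x * val d)]).
  apply: (@mulgr_continuous G (val d) g); apply: open_nbhs_nbhs.
  by split=> //; exact: open_interior.
have [[y' g'] [Syg [/= nal' Pg'd]]] := clyg _ (filterI n1 n2).
case: nal'; exists (sdp_src Pgen (sdp_mk Syg)) => //.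
rewrite -(@sdp_srcP _ _ Pgen _ _ (sdp_mk Syg) (toP (g' * val d)) d)//=.
by rewrite val_toP ?mulgK//; exact: interior_subset.
Qed.

Lemma closed_Qset y : closed (Qset actY y).
Proof.
apply: (@preimage_closed _ _ (fun g : G => (y, g)) (sdp_set actY)).
  by move=> g _; apply: cvg_pair => /=; [exact: cvg_cst|exact: cvg_id].
exact: closed_sdp_set.
Qed.

Lemma Qset_near_misses y (K : set G) : compact K -> Qset actY y `&` K = set0 ->
  \forall z \near y, Qset actY z `&` K = set0.
Proof.
move=> cK QK; have /compact_near_coveringP cov := cK.
have near_y : \forall z \near y, K `<=` (fun g => ~ Qset actY z g).
  apply: (cov Y (nbhs y) (fun z g => ~ Qset actY z g)) => g Kg.
  have : nbhs (y, g) (~` sdp_set actY).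
    apply: open_nbhs_nbhs; split; first exact/closed_openC/closed_sdp_set.
    by move=> Qg; have : (Qset actY y `&` K) g by []; rewrite QK.
  move=> [[U V] /= [Uy Vg] UV]; exists (V, U) => // -[h z] /= [Vh Uz].
  exact: (UV (z, h)).
by apply: filterS near_y => z Kz; rewrite -subset0 => g [Qg /Kz].
Qed.

Lemma compact_sdp_cocycle (K : set G) : compact K ->
  compact [set h : sdp actY | K (sdp_cocycle h)].
Proof.
move=> cK; apply: compact_set_type.
have -> : [set val h | h in [set h : sdp actY | K (sdp_cocycle h)]] =
    ([set: Y] `*` K) `&` sdp_set actY.
  apply/seteqP; split=> [_ [h Kh <-]|z [[_ Kz] Sz]].
    by split=> //; exact: set_mem (valP h).
  by exists (sdp_mk Sz).
by apply: compact_closedI; [exact: compact_setX|exact: closed_sdp_set].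
Qed.

Section haar_system.
Local Open Scope ring_scope.
Variable lam : Y -> {measure set (borelType (sdp actY)) -> \bar R}.
Hypothesis hlam : @is_haar_system R (semidirect Pgen actY) lam.

(** The support condition only supplies a null neighbourhood of each point off the fibre;
    compactness reduces these to finitely many. *)
Lemma haar_null_compact y (K : set (sdp actY)) : compact K ->
  (forall h, K h -> sdp_rng h <> y) -> lam y K = 0%E.
Proof.
move=> cK Ky; have hS : hausdorff_space (sdp actY) by exact: sdp_hausdorff.
have pick h : exists U : set (sdp actY), K h -> [/\ open U, U h & lam y U = 0%E].
  have [Kh|] := pselect (K h); last by exists set0.
  have : ~ measure_support (lam y) h.
    by rewrite (haar_support hlam) => /Ky; exact.
  move=> /existsNP[U /not_implyP[oU /not_implyP[Uh /negP]]].
  by rewrite -leNgt => U0; exists U; split=> //; apply/eqP; rewrite eq_le U0 measure_ge0.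
pose U h := sval (cid (pick h)).
have UP h : K h -> [/\ open (U h), U h h & lam y (U h) = 0%E].
  exact: svalP (cid (pick h)).
have [|s [sK Ks]] := @compact_finite_cover _ K U cK.
  by move=> h /UP[oU Uh _]; exact: open_nbhs_nbhs.
pose V := \big[setU/set0]_(h <- s) U h.
have [mV V0] : measurable (V : set (borelType (sdp actY))) /\ lam y V = 0%E.
  rewrite /V big_seq; elim/big_ind : _ => [|A B [mA A0] [mB B0]|h /sK/UP[oU _ U0]].
  - by rewrite measure0.
  - by split; [exact: measurableU|rewrite measureU0].
  - by split=> //; exact: open_borel.
apply/eqP; rewrite eq_le measure_ge0 andbT -V0.
apply: le_measure; rewrite ?inE//; first exact: compact_borel.
by move=> h /Ks[h' h's Uh]; rewrite /V -bigcup_seq; exists h'.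
Qed.

Lemma haar_integral0 y (f : sdp actY -> R) : continuous f ->
  compactly_supported f ->
  (forall h, closure [set h | f h != 0] h -> sdp_rng h <> y) ->
  \int[lam y]_h f h = 0.
Proof.
move=> cf kf fy; have K0 := haar_null_compact kf fy.
set K := closure _ in K0.
have mK : measurable (K : set (borelType (sdp actY))).
  by apply: closed_borel; exact: closed_closure.
rewrite /Rintegral -[RHS]/(fine 0%E); congr fine.
have mf : measurable_fun setT (f : borelType (sdp actY) -> R).
  exact: continuous_borelR.
transitivity (\int[lam y]_(h in K) (f h)%:E)%E.
  rewrite [RHS]integral_mkcond; apply: eq_integral => h _.
  rewrite /patch; case: ifPn => // /negP hK; have [->//|fh] := eqVneq (f h) 0.
  by case: hK; apply: mem_set; exact: subset_closure.
apply: null_set_integral => //.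
by apply: measurable_funTS; exact/measurable_EFinP.
Qed.

Lemma haar_integral_gt0 y (f : sdp actY -> R) h : continuous f ->
  compactly_supported f -> (forall h, 0 <= f h <= 1) -> sdp_rng h = y ->
  0 < f h -> 0 < \int[lam y]_h f h.
Proof.
move=> cf kf f01 hy fh.
have mf : measurable_fun setT (f : borelType (sdp actY) -> R).
  exact: continuous_borelR.
set K := closure [set h | f h != 0] in kf *.
have mK : measurable (K : set (borelType (sdp actY))).
  by apply: closed_borel; exact: closed_closure.
pose O := [set k | f h / 2 < f k].
have oO : open O.
  rewrite (_ : O = f @^-1` [set x | f h / 2 < x])//.
  by apply: open_comp => [x _|]; [exact: cf|exact: open_gt].
have mO : measurable (O : set (borelType (sdp actY))) by exact: open_borel.
have Oh : O h by rewrite /O /= ltr_pdivrMr// mulr_natr mulr2n ltrDl.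
have O0 : (0 < lam y O)%E.
  have : measure_support (lam y) h by rewrite (haar_support hlam).
  exact.
have mfE : measurable_fun setT (EFin \o (f : borelType (sdp actY) -> R)).
  exact/measurable_EFinP.
(* The real integral is [fine] of the extended one and would be 0 at infinity, so finiteness has to
   be proved as well: [f] is at most the indicator of its compact support. *)
apply: fine_gt0; apply/andP; split.
  apply: (@lt_le_trans _ _ (\int[lam y]_(k in O) (cst (f h / 2)%:E) k)%E).
    by rewrite integral_cst// mule_gt0// lte_fin divr_gt0.
  apply: (@le_trans _ _ (\int[lam y]_(k in O) (f k)%:E)%E).
    apply: ge0_le_integral => //.
    - by move=> k _; rewrite lee_fin divr_ge0// ltW.
    - exact: measurable_funTS.
    - by move=> k Ok; rewrite lee_fin ltW.
  apply: ge0_subset_integral => // k _; rewrite lee_fin.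
  by have /andP[] := f01 k.
apply: (@le_lt_trans _ _ (\int[lam y]_k (\1_K k)%:E)%E).
  apply: ge0_le_integral => //.
  - by move=> k _; rewrite lee_fin; have /andP[] := f01 k.
  - by apply/measurable_EFinP; exact: measurable_indic.
  - move=> k _; rewrite lee_fin indicE; have [->|fk] := eqVneq (f k) 0.
      exact: ler0n.
    rewrite mem_set; last exact: subset_closure.
    by have /andP[] := f01 k.
by rewrite integral_indic// setIT; exact: (haar_radon hlam).
Qed.

(* The integral of a bump function depends continuously on the unit, so it
   stays positive near y: the range map is open. *)
Lemma Qset_near_hits y (U : set G) : open U -> Qset actY y `&` U !=set0 ->
  \forall z \near y, Qset actY z `&` U !=set0.
Proof.
move=> oU [g [Qg Ug]].
have [V [Vg cV clV VU]] := lc_compact_nbhs hG lcG (open_nbhs_nbhs (conj oU Ug)).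
have [phi [cphi phi01 phi0 phi1]] : exists phi : G -> R, [/\ continuous phi,
    range phi `<=` `[0, 1], phi @` [set g] `<=` [set 0] &
    phi @` (~` V°) `<=` [set 1]].
  apply/uniform_separatorP.
  apply: (@locally_compact_completely_regular G R lcG hG).
    by apply: open_closedC; exact: open_interior.
  by apply.
(* The separating function [phi] is 0 at [g] and 1 off the interior of [V]; its complement to 1 is
   the bump, pulled back to the arrows. *)
pose f (h : sdp actY) := 1 - phi (sdp_cocycle h).
have cf : continuous f.
  move=> h; apply: (@cvgB R R _ (nbhs h) _ (cst 1) (fun h => phi (sdp_cocycle h))).
    exact: cst_continuous.
  apply: (@continuous_comp _ _ _ (@sdp_cocycle _ _ _ actY) phi); last exact: cphi.
  exact: sdp_cocycle_continuous.
have fV : closure [set h | f h != 0] `<=` [set h | V (sdp_cocycle h)].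
  have clC : closed [set h : sdp actY | V (sdp_cocycle h)].
    apply: (@preimage_closed _ _ (@sdp_cocycle _ _ _ actY) V) => //.
    by move=> h _; exact: sdp_cocycle_continuous.
  rewrite [X in _ `<=` X]((closure_id _).1 clC); apply: closureS => h /=.
  move=> fh; apply: contrapT => nVh; move/eqP : fh; apply.
  have : [set 1] (phi (sdp_cocycle h)).
    apply: phi1; exists (sdp_cocycle h) => // /interior_subset.
    exact: nVh.
  by rewrite /f => ->; rewrite subrr.
(* Compactness of [Y] enters here: the arrows over [V] form a closed subset of the compact product
   of [Y] and [V]. *)
have kf : compactly_supported f.
  apply: subclosed_compact fV; first exact: closed_closure.
  exact: compact_sdp_cocycle.
have f01 h : 0 <= f h <= 1.
  have : `[0, 1]%classic (phi (sdp_cocycle h)) by apply: phi01; exists (sdp_cocycle h).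
  by rewrite /= in_itv/= /f subr_ge0 lerBlDr lerDl andbC.
have fg : 0 < f (sdp_arrow actY y g).
  rewrite /f sdp_cocycle_arrow// (_ : phi g = 0) ?subr0//.
  by apply: phi0; exists g.
have I0 := haar_integral_gt0 cf kf f01 (sdp_rng_arrow actY y g) fg.
have near_y : \forall z \near y, 0 < \int[lam z]_h f h.
  have nI : nbhs (\int[lam y]_h f h) [set x : R | 0 < x].
    by apply: open_nbhs_nbhs; split; first exact: open_gt.
  exact: (@haar_continuous _ _ _ hlam f cf kf y _ nI).
apply: (@filterS _ _ (@nbhs_filter Y y) _ _ _ near_y) => z Iz.
apply: contrapT => nQ; move: Iz; rewrite haar_integral0 ?ltxx// => h /fV Vh hz.
apply: nQ; exists (sdp_cocycle h); split; last exact: VU.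
by rewrite -hz; exact: Qset_cocycle.
Qed.

End haar_system.

End compact_action.

(** * Universality *)

Section universality.
Context (R : realType) (G : topologicalGroupType).
Hypotheses (hG : hausdorff_space G) (lcG : locally_compact [set: G]).
Context (P : submonoid G) (Pclosed : closed P).
Hypothesis Pgen : forall g : G, exists a b : P, g = val a / val b.
Hypothesis Pint : (P : set G) `<=` closure (interior P).
Local Notation X := (order_compactification Pclosed).
Local Notation actX := (order_action Pclosed hG lcG).
Context (Y : ptopologicalType) (actY : injective_action P Y).
Hypotheses (hY : hausdorff_space Y) (cY : compact [set: Y]).
Hypothesis haarY : has_haar_system R (semidirect Pgen actY).

(** The arrow [(y, a)] has source [y a], so this is [Qset_src] for that arrow. *)
Lemma Qset_act y (a : P) x : Qset actY (actY y a) x <-> Qset actY y (val a * x).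
Proof.
have Sya : sdp_set actY (y, val a).
  exists a, (sub1 P), (actY y a); split; first by rewrite /= invg1 mulg1.
  by rewrite act1.
have src : sdp_src Pgen (sdp_mk Sya) = actY y a.
  apply: (@sdp_src_unique _ _ Pgen _ _ _ a (sub1 P)) => /=; last by rewrite act1.
  by rewrite invg1 mulg1.
by rewrite -src -(Qset_src Pgen (sdp_mk Sya)).
Qed.

Definition closed_setV_Qset (y : Y) : closedSet G :=
  ClosedSet (closed_setV (@closed_Qset _ _ Pgen Pint _ actY hY cY y)).

Lemma closed_setV_Qset_continuous : continuous closed_setV_Qset.
Proof.
have [lam hlam] := haarY.
have Vmeets y (U : set G) : setV (Qset actY y) `&` setV U !=set0 <->
    Qset actY y `&` U !=set0.
  split=> [[_ [[g Qg <-]]]|[g [Qg Ug]]].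
    by rewrite setVE /= invgK => Ug; exists g.
  by exists g^-1; split; [exists g|exists g].
have VK (U : set G) : setV (setV U) = U by exact: setVK.
move=> y; apply: cvg_vietoris => /=.
- move=> K cK; rewrite /misses /= -(VK K) => QK.
  have cVK : compact (setV K) by exact: setV_compact.
  have /(Qset_near_misses Pgen Pint hY cY cVK) nearQ :
      Qset actY y `&` setV K = set0.
    by apply: contrapT => /eqP/set0P/Vmeets; rewrite QK => -[].
  apply: (@filterS _ _ (@nbhs_filter Y y) _ _ _ nearQ) => z Qz.
  by apply: contrapT => /eqP/set0P/Vmeets; rewrite Qz => -[].
- move=> U oU; rewrite /hits /= -(VK U) => /Vmeets QU.
  have oVU : open (setV U).
    by rewrite setVE; apply: open_comp => // g _; exact: invg_continuous.
  have nearQ := Qset_near_hits hG lcG Pint hY cY hlam oVU QU.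
  apply: (@filterS _ _ (@nbhs_filter Y y) _ _ _ nearQ) => z Qz.
  exact/Vmeets.
Qed.

Variable y0 : Y.
Hypotheses (A1 : conditionA1 actY y0) (A2 : conditionA2 actY y0).

Lemma closed_setV_Qset_orbit (a : P) :
  closed_setV_Qset (actY y0 a) = setMr (setV P) (val a) :> set G.
Proof.
rewrite /= setVE setMrE; apply/seteqP; split=> g /=.
- move=> /Qset_act; rewrite A1 => Pag.
  by rewrite setVE /= invgM invgK.
- rewrite setVE /= invgM invgK => Pag; apply/Qset_act.
  by rewrite A1.
Qed.

Lemma order_closure_Qset y : order_closure Pclosed (closed_setV_Qset y).
Proof.
move=> U nU; have : nbhs y (closed_setV_Qset @^-1` U).
  exact: closed_setV_Qset_continuous.
rewrite nbhsE => -[V [oV Vy] VU].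
have [z [Vz [a _ za]]] := A2 (ex_intro _ y Vy) oV.
exists (closed_setV_Qset (actY y0 a)); split; last by apply: VU; rewrite za.
exists (val a); first exact: set_mem (valP a).
by apply: closedSet_inj; rewrite closed_setV_Qset_orbit.
Qed.

Definition to_order (y : Y) : X :=
  exist (fun B => B \in order_closure Pclosed) _ (mem_set (@order_closure_Qset y)).

Lemma to_order_continuous : continuous to_order.
Proof.
apply: (@continuous_comp_initial _ _ _ (@set_val _ (order_closure Pclosed))).
exact: closed_setV_Qset_continuous.
Qed.

Lemma to_order_equivariant : equivariant actY actX to_order.
Proof.
move=> y a; apply: val_inj; apply: closedSet_inj => /=.
rewrite setMrE setVE setVE; apply/seteqP; split=> g /=.
- by move/Qset_act; rewrite invgM invgK.
- by rewrite invgM invgK => Qag; apply/Qset_act.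
Qed.

Lemma to_order_surjective (A : X) : exists y, to_order y = A.
Proof.
(* The range is compact, hence closed, and it contains every [P^-1 a] as the image of [y0 a]. *)
have clI : closed (range to_order).
  apply: compact_closed; first exact: order_compactification_hausdorff.
  apply: continuous_compact => //; apply: continuous_subspaceT.
  exact: to_order_continuous.
suff /clI[y _ yA] : closure (range to_order) A by exists y.
move=> U; rewrite nbhsE => -[_ [[V oV <-] /= VA] VU].
have [a Pa [B VB BE]] := order_closureP (open_nbhs_nbhs (conj oV VA)).
exists (to_order (actY y0 (exist _ a (mem_set Pa)))); split; first by eexists.
apply: VU; rewrite /= (_ : set_val _ = B)//.
by apply: closedSet_inj; rewrite BE; exact: closed_setV_Qset_orbit.
Qed.

Lemma to_order_homeomorphism : conditionA3 actY -> homeomorphism to_order.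
Proof.
move=> A3; apply: compact_bijection_homeomorphism => //.
- exact: order_compactification_hausdorff.
- exact: to_order_continuous.
exists (fun A => sval (cid (to_order_surjective A))) => [y|A]; last first.
  exact: svalP (cid (to_order_surjective A)).
apply: A3; have /(congr1 val) := svalP (cid (to_order_surjective (to_order y))).
move=> /(congr1 (@closedSet_set _)) /= /(congr1 (@setV G)).
by rewrite !setVK.
Qed.

End universality.

Theorem proposition5p1 (R : realType) (G : topologicalGroupType)
    (hG : hausdorff_space G) (scG : @second_countable G)
    (lcG : locally_compact [set: G])
    (P : submonoid G) (Pclosed : closed P)
    (Pgen : forall g : G, exists a b : P, g = val a / val b)
    (Pint : (P : set G) `<=` closure (interior P)) :
  let X := order_compactification Pclosed in
  let actX : injective_action P X := order_action Pclosed hG lcG in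
  [/\ has_haar_system R (semidirect Pgen actX),
      conditionsA actX &
      forall (Y : ptopologicalType) (actY : injective_action P Y),
        hausdorff_space Y -> @second_countable Y -> compact [set: Y] ->
        has_haar_system R (semidirect Pgen actY) -> conditionsA actY ->
        exists phi : Y -> X,
          [/\ forall y, (val (phi y) : closedSet G) = setV (Qset actY y) :> set G,
              equivariant actY actX phi &
              homeomorphism phi]].
Proof.
have [mu hmu] := @haar_measure_exists R G hG lcG.
split; first exact: (order_has_haar_system hG scG lcG Pclosed Pgen Pint hmu).
  exact: order_conditionsA.
move=> Y actY hY _ cY haarY [[y0 [A1 A2]] A3].
exists (to_order hG lcG Pclosed Pint hY cY haarY A1 A2); split.
- by [].
- exact: to_order_equivariant.
- exact: to_order_homeomorphism.
Qed.
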